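(* Let $q_k$ be the marginal density of the discrete forward chain variable $\tilde X_k$ at step $k$, and let $$\mathcal{L}_{\mathrm{DDPM}}(\theta):=\mathbb{E}_{\tilde X_0,K,\varepsilon}\Bigl[\bigl\|\epsilon_\theta(\tilde X_K,K)-\varepsilon\bigr\|_2^2\Bigr].$$ Then there is a constant $C$ independent of $\theta$ such that $$\mathcal{L}_{\mathrm{DDPM}}(\theta)=\mathbb{E}_{\tilde X_0,K,\varepsilon}\Bigl[\bigl\|\epsilon_\theta(\tilde X_K,K)+\sqrt{1-\bar a_K}\,\nabla\log q_K(\tilde X_K)\bigr\|_2^2\Bigr]+C.$$ Moreover, under the identification $X_{t_k}\equiv\tilde X_k$, $p_{t_k}=q_k$, $\alpha_{t_k}=\sqrt{\bar a_k}$, $\sigma_{t_k}=\sqrt{1-\bar a_k}$, $\epsilon_\theta(\cdot,k)=\epsilon_\theta(\cdot,t_k)$, the first term on the right-hand side is exactly the grid-restricted reverse-SDE training objective $$\mathbb{E}_K\,\mathbb{E}_{X_{t_K}\sim p_{t_K}}\Bigl[\bigl\|\epsilon_\theta(X_{t_K},t_K)+\sigma_{t_K}\nabla\log p_{t_K}(X_{t_K})\bigr\|_2^2\Bigr].$$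
   Context: Discrete schedule: $0=t_0<t_1<\cdots<t_N=1$ is a time grid, $b_k\in(0,1)$, $a_k:=1-b_k$, $\bar a_k:=\prod_{i=1}^ka_i$. Sampling: $\tilde X_0\sim p_0$ (a probability density on $\mathbb{R}^d$), $K\sim\mathrm{Unif}\{1,\dots,N\}$ and $\varepsilon\sim\mathcal{N}(0,I)$ are independent, and $\tilde X_k:=\sqrt{\bar a_k}\,\tilde X_0+\sqrt{1-\bar a_k}\,\varepsilon$ for each $k$ (so $\tilde X_K$ is obtained with $k=K$). $\epsilon_\theta(\cdot,k):\mathbb{R}^d\to\mathbb{R}^d$ are measurable functions depending on a parameter $\theta$; they are the restriction to the grid of a continuous-time predictor $\epsilon_\theta(x,t)$. The corresponding continuous-time process is $X_t=\alpha_tX_0+\sigma_t\varepsilon$ with density $p_t(x)=\int\mathcal{N}(x;\alpha_tx_0,\sigma_t^2I)p_0(x_0)\,\mathrm{d}x_0$. Losses are allowed to take values in $[0,\infty]$. *)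

(* Defs.v *)
From HB Require Import structures.
From mathcomp Require Import all_boot all_order all_algebra.
From mathcomp Require Import all_classical all_reals all_analysis.

Set Implicit Arguments.
Unset Strict Implicit.
Unset Printing Implicit Defensive.

Import Order.TTheory GRing.Theory Num.Theory.
Import numFieldNormedType.Exports.

Local Open Scope classical_set_scope.
Local Open Scope ring_scope.

Definition measure_rV_display : measure_display -> measure_display.
Proof. exact. Qed.

(* The sigma-algebra generated by the coordinates; over a realType it is the
   Borel sigma-algebra of R^n. *)
Section measurable_rV.
Context {d} {T : measurableType d} (n : nat).

Let coor : 'I_n -> 'rV[T]_n -> T := fun i x => x ord0 i.

Let rV_set0 : g_sigma_preimage coor set0.
Proof. exact: sigma_algebra0. Qed.

Let rV_setC A : g_sigma_preimage coor A -> g_sigma_preimage coor (~` A).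
Proof. exact: sigma_algebraC. Qed.

Let rV_bigcup (F : (set 'rV[T]_n)^nat) :
  (forall i, g_sigma_preimage coor (F i)) ->
  g_sigma_preimage coor (\bigcup_i (F i)).
Proof. exact: sigma_algebra_bigcup. Qed.

HB.instance Definition _ := @isMeasurable.Build (measure_rV_display d)
  'rV[T]_n (g_sigma_preimage coor) rV_set0 rV_setC rV_bigcup.

End measurable_rV.

Lemma measurable_fun_rVP d d' (T : measurableType d) (T' : measurableType d') n
    (f : T -> 'rV[T']_n) :
  (forall i, measurable_fun [set: T] (fun x => f x ord0 i)) ->
  measurable_fun [set: T] f.
Proof.
move=> mf; have : g_sigma_preimage (fun i (x : 'rV[T']_n) => x ord0 i) `<=`
    [set A | measurable (f @^-1` A)].
  apply: smallest_sub.
    split => /=; first by rewrite preimage_set0.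
      by move=> A mA; rewrite setTD preimage_setC; exact: measurableC.
    by move=> F mF; rewrite preimage_bigcup; exact: bigcupT_measurable.
  case: n => [|n] in f mf *; first by rewrite big_ord0.
  rewrite -bigcup_mkord_ord; apply: bigcup_sub => i Ii.
  move=> A [B mB <-] /=; rewrite setTI -[X in measurable X]setTI.
  exact: mf.
by move=> fS _ A mA; rewrite setTI; exact: fS.
Qed.

Lemma measurable_coord d (T : measurableType d) n (i : 'I_n) :
  measurable_fun [set: 'rV[T]_n] (fun x => x ord0 i).
Proof.
move=> _ Y mY; rewrite setTI; apply: sub_sigma_algebra => /=.
rewrite -bigcup_seq/=; exists i => /=; first by rewrite mem_index_enum.
by exists Y => //; rewrite setTI.
Qed.

Lemma sigma_finite_product_measure d1 d2 (T1 : measurableType d1)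
    (T2 : measurableType d2) (R : realType)
    (m1 : {sigma_finite_measure set T1 -> \bar R})
    (m2 : {sigma_finite_measure set T2 -> \bar R}) :
  sigma_finite setT (m1 \x m2)%E.
Proof.
have /sigma_finiteP[F [TF ndF Foo]] := sigma_finiteT m1.
have /sigma_finiteP[G [TG ndG Goo]] := sigma_finiteT m2.
exists (fun n => F n `*` G n).
  rewrite -setXTT TF TG predeqE => -[x y]; split.
    move=> [/= [n _ Fnx] [k _ Gky]]; exists (maxn n k) => //; split.
      by move: x Fnx; exact/subsetPset/ndF/leq_maxl.
    by move: y Gky; exact/subsetPset/ndG/leq_maxr.
  by move=> [n _ []/= ? ?]; split; exists n.
move=> k; have [? ?] := Foo k; have [? ?] := Goo k.
split; first exact: measurableX.
by rewrite product_measure1E// lte_mul_pinfty// ge0_fin_numE.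
Qed.

Section lebesgue_measure_rV.
Context {R : realType}.
Local Open Scope ereal_scope.

Definition cons_rV n (p : R * 'rV[R]_n) : 'rV[R]_n.+1 :=
  row_mx (p.1)%:M p.2.

Lemma cons_rV_ord0 n (p : R * 'rV[R]_n) : cons_rV p ord0 ord0 = p.1.
Proof.
transitivity ((p.1%:M : 'M[R]_1) ord0 ord0); last by rewrite mxE mulr1n.
rewrite (_ : ord0 = lshift n (ord0 : 'I_1)); last exact: val_inj.
exact: row_mxEl.
Qed.

Lemma cons_rV_lift n (p : R * 'rV[R]_n) (j : 'I_n) :
  cons_rV p ord0 (lift ord0 j) = p.2 ord0 j.
Proof.
rewrite (_ : lift ord0 j = rshift 1 j); last exact: val_inj.
exact: row_mxEr.
Qed.

Lemma measurable_cons_rV n :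
  measurable_fun [set: R * 'rV[R]_n] (@cons_rV n).
Proof.
apply: measurable_fun_rVP => i; have [j ->|->] := unliftP ord0 i.
  rewrite (_ : (fun _ => _) = (fun x : 'rV[R]_n => x ord0 j) \o snd).
    by apply: measurableT_comp => //; exact: measurable_coord.
  by apply/funext => p; exact: cons_rV_lift.
by rewrite (_ : (fun _ => _) = fst)//; apply/funext => p; exact: cons_rV_ord0.
Qed.

Section lebesgue_cons.
Variables (n : nat) (mu : {sigma_finite_measure set 'rV[R]_n -> \bar R}).

Definition lebesgue_cons : set 'rV[R]_n.+1 -> \bar R :=
  pushforward (lebesgue_measure \x mu) (@cons_rV n).

Let m : {measure set 'rV[R]_n.+1 -> \bar R} :=
  measure_function_pushforward__canonical__measure_function_Measure
    (lebesgue_measure \x mu) (@measurable_cons_rV n).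

HB.instance Definition _ := Measure.copy lebesgue_cons m.

Let lebesgue_cons_sigma_finite : sigma_finite setT lebesgue_cons.
Proof.
have [F FT Foo] : sigma_finite setT (lebesgue_measure \x mu).
  exact: sigma_finite_product_measure.
pose uncons (v : 'rV[R]_n.+1) : R * 'rV[R]_n :=
  (v ord0 ord0, \row_j v ord0 (lift ord0 j)).
have cons_rVK : cancel (@cons_rV n) uncons.
  move=> [x v]; rewrite /uncons cons_rV_ord0; congr pair.
  by apply/rowP => j; rewrite mxE cons_rV_lift.
have measurable_uncons : measurable_fun [set: 'rV[R]_n.+1] uncons.
  apply: measurable_fun_pair; first exact: measurable_coord.
  apply: measurable_fun_rVP => i; rewrite (_ : (fun _ => _) =
    (fun v : 'rV[R]_n.+1 => v ord0 (lift ord0 i))); first exact: measurable_coord.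
  by apply/funext => v; rewrite mxE.
exists (fun i => uncons @^-1` F i); first by rewrite -preimage_bigcup -FT.
move=> i; have [mF Fi] := Foo i; split.
  by rewrite -[X in measurable X]setTI; exact: measurable_uncons.
rewrite /lebesgue_cons /pushforward -comp_preimage.
by rewrite (_ : uncons \o _ = idfun)//; apply/funext => p; exact: cons_rVK.
Qed.


HB.instance Definition _ := Measure_isSigmaFinite.Build _ _ _ lebesgue_cons
  lebesgue_cons_sigma_finite.

End lebesgue_cons.

Fixpoint lebesgue_rV n : set 'rV[R]_n -> \bar R :=
  match n with
  | 0 => \d_(0%R : 'rV[R]_0)
  | n.+1 => pushforward (lebesgue_measure \x @lebesgue_rV n) (@cons_rV n)
  end.

Arguments lebesgue_rV n A : clear implicits.

Lemma lebesgue_rV_sigma_finite_measure n :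
  exists mu : {sigma_finite_measure set 'rV[R]_n -> \bar R},
    lebesgue_rV n = mu.
Proof.
elim: n => [|n [mu IH]].
  by exists (\d_(0%R : 'rV[R]_0) : {sigma_finite_measure set _ -> \bar R}).
by exists (lebesgue_cons mu); rewrite /= IH.
Qed.
Let lebesgue_rV0 n : lebesgue_rV n set0 = 0.
Proof. by have [mu ->] := lebesgue_rV_sigma_finite_measure n. Qed.

Let lebesgue_rV_ge0 n A : 0 <= lebesgue_rV n A.
Proof. by have [mu ->] := lebesgue_rV_sigma_finite_measure n. Qed.

Let lebesgue_rV_sigma_additive n : semi_sigma_additive (lebesgue_rV n).
Proof.
have [mu ->] := lebesgue_rV_sigma_finite_measure n.
exact: measure_semi_sigma_additive.
Qed.

HB.instance Definition _ n := isMeasure.Build _ _ _ (lebesgue_rV n)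
  (lebesgue_rV0 n) (@lebesgue_rV_ge0 n) (@lebesgue_rV_sigma_additive n).

Let lebesgue_rV_sigma_finite n : sigma_finite setT (lebesgue_rV n).
Proof.
have [mu ->] := lebesgue_rV_sigma_finite_measure n.
exact: sigma_finiteT.
Qed.

HB.instance Definition _ n := Measure_isSigmaFinite.Build _ _ _ (lebesgue_rV n)
  (lebesgue_rV_sigma_finite n).

Lemma lebesgue_rV_box n (A : 'I_n -> set R) : (forall i, measurable (A i)) ->
  lebesgue_rV n [set x | forall i, A i (x ord0 i)] =
  \prod_(i < n) lebesgue_measure (A i).
Proof.
elim: n A => [|n IH] A mA.
  rewrite big_ord0 /= diracE mem_set//; by case.
rewrite big_ord_recl -IH//.
set B := [set x : 'rV[R]_n | forall i, A (lift ord0 i) (x ord0 i)].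
have mB : measurable B.
  rewrite (_ : B = \bigcap_(i in [set: 'I_n])
      (fun x : 'rV[R]_n => x ord0 i) @^-1` A (lift ord0 i)).
    apply: fin_bigcap_measurable => // i _.
    by rewrite -[X in measurable X]setTI; exact: measurable_coord.
  by apply/seteqP; split=> x Bx i; [move=> _; exact: Bx|exact: Bx].
rewrite -product_measure1E//; last exact: mA.
apply: (congr1 (product_measure1 lebesgue_measure (lebesgue_rV n))).
apply/seteqP; split => -[x v] /= Axv.
  split => [|i]; first by have := Axv ord0; rewrite cons_rV_ord0.
  by have := Axv (lift ord0 i); rewrite cons_rV_lift.
move=> i; have [j ->|->] := unliftP ord0 i.
  by rewrite cons_rV_lift; exact: Axv.2.
by rewrite cons_rV_ord0; exact: Axv.1.
Qed.

End lebesgue_measure_rV.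
Arguments lebesgue_rV {R} n A.

Section vector_calculus.
Context {R : realType} {n : nat}.
Implicit Types (x m : 'rV[R]_n) (f : 'rV[R]_n -> R).

(* The library norm on matrices is the sup norm. *)
Definition norm2 x : R := Num.sqrt (\sum_i x ord0 i ^+ 2).

Definition gradient f x : 'rV[R]_n := \row_i 'D_(delta_mx ord0 i) f x.

(* density of N(m, s^2 I) *)
Definition gaussian_pdf m (s : R) x : R :=
  normal_peak s ^+ n * expR (- norm2 (x - m) ^+ 2 / (s ^+ 2 *+ 2)).

End vector_calculus.

Section random_vectors.
Context {R : realType} {d} {Omega : measurableType d} (P : probability Omega R).

Definition has_density n (X : Omega -> 'rV[R]_n) (f : 'rV[R]_n -> R) : Prop :=
  [/\ measurable_fun [set: 'rV[R]_n] f,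
      forall x, 0 <= f x &
      forall A, measurable A ->
        (P (X @^-1` A) = \int[lebesgue_rV n]_(x in A) (f x)%:E)%E].

Definition uniform_on_1_to (N : nat) (K : Omega -> nat) : Prop :=
  forall k, P (K @^-1` [set k]) =
    (if (1 <= k <= N)%N then N%:R^-1 else 0)%:E.

Definition independent3 d1 d2 d3 (T1 : measurableType d1)
    (T2 : measurableType d2) (T3 : measurableType d3)
    (X : Omega -> T1) (Y : Omega -> T2) (Z : Omega -> T3) : Prop :=
  forall A B C, measurable A -> measurable B -> measurable C ->
    P (X @^-1` A `&` Y @^-1` B `&` Z @^-1` C) =
    (P (X @^-1` A) * P (Y @^-1` B) * P (Z @^-1` C))%E.

End random_vectors.

Section discrete_chain.
Context {R : realType} {n : nat}.

Definition alpha_bar (b : nat -> R) (k : nat) : R :=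
  \prod_(1 <= i < k.+1) (1 - b i).

Definition forward_chain {Omega : Type} (b : nat -> R)
    (X0 eps : Omega -> 'rV[R]_n) (k : nat) (w : Omega) : 'rV[R]_n :=
  Num.sqrt (alpha_bar b k) *: X0 w + Num.sqrt (1 - alpha_bar b k) *: eps w.

Context {d} {Omega : measurableType d} (P : probability Omega R).
Variables (b : nat -> R) (X0 : Omega -> 'rV[R]_n) (K : Omega -> nat)
  (eps : Omega -> 'rV[R]_n).

Definition ddpm_loss (predictor : 'rV[R]_n -> nat -> 'rV[R]_n) : \bar R :=
  'E_P[fun w =>
    norm2 (predictor (forward_chain b X0 eps (K w) w) (K w) - eps w) ^+ 2].

Definition chain_score_loss (q : nat -> 'rV[R]_n -> R)
    (predictor : 'rV[R]_n -> nat -> 'rV[R]_n) : \bar R :=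
  'E_P[fun w =>
    let x := forward_chain b X0 eps (K w) w in
    norm2 (predictor x (K w) + Num.sqrt (1 - alpha_bar b (K w)) *:
             gradient (fun y => ln (q (K w) y)) x) ^+ 2].

End discrete_chain.

Section continuous_process.
Context {R : realType} {n : nat}.
Variables (alpha sigma : R -> R).

Definition continuous_process {Omega : Type} (X0 eps : Omega -> 'rV[R]_n)
    (s : R) (w : Omega) : 'rV[R]_n :=
  alpha s *: X0 w + sigma s *: eps w.

Definition process_density (p0 : 'rV[R]_n -> R) (s : R) (x : 'rV[R]_n) : R :=
  \int[lebesgue_rV n]_x0 (gaussian_pdf (alpha s *: x0) (sigma s) x * p0 x0).

(* E_K E_{X ~ p_{t_K}} || eps(X, t_K) + sigma_{t_K} grad log p_{t_K}(X) ||^2,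
   the inner expectation being an integral against the density p_{t_K} *)
Definition reverse_sde_grid_loss {d} {Omega : measurableType d}
    (P : probability Omega R) (K : {RV P >-> nat}) (t : nat -> R)
    (p : R -> 'rV[R]_n -> R)
    (predictor : 'rV[R]_n -> R -> 'rV[R]_n) : \bar R :=
  (\int[distribution P K]_k \int[lebesgue_rV n]_x
    (norm2 (predictor x (t k) + sigma (t k) *:
              gradient (fun y => ln (p (t k) y)) x) ^+ 2 * p (t k) x)%:E)%E.

End continuous_process.

(* Main.v *)
(* Fix a step k and write X = a X0 + s eps. Conditioning on X splits the loss
   |f(X) - eps|^2 into |f(X) - m(X)|^2 and |m(X) - eps|^2, where m(x) is the
   conditional expectation of eps given X = x; the second term does not involve
   f and is at most E|eps|^2 < oo. After the substitution eps = (x - a z) / s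
   and Tonelli, the splitting is an identity for each fixed x, between integrals
   of bounded functions against the law of X0, so that it survives when the
   losses are infinite.

   The Gaussian mixture M(x) = E[s^-n phi((x - a X0) / s)] is a continuous
   density of X, hence equals q_k everywhere, and differentiating it under the
   integral gives Tweedie's formula s grad log q_k = - m. Independence of K
   turns the expectation into an average over k. *)

Require Import Defs.
From HB Require Import structures.
From mathcomp Require Import all_boot all_order all_algebra.
From mathcomp Require Import all_classical all_reals all_analysis.
From mathcomp Require Import measurable_realfun ring lra.

Import Order.TTheory GRing.Theory Num.Theory.
Import numFieldNormedType.Exports.

Local Open Scope classical_set_scope.
Local Open Scope ring_scope.

(** * Integration *)

Section integral_general.
Local Open Scope ereal_scope.
Import HBNNSimple.

(** On simple functions the identity is the hypothesis on [nu] applied to level sets. Monotone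
    convergence on both sides extends it to every measurable non-negative [f], including those with
    infinite integral. *)
Lemma ge0_integral_density d (T : measurableType d) (R : realType)
    (nu mu : {measure set T -> \bar R}) (p : T -> R) (f : T -> \bar R) :
  measurable_fun setT p -> (forall x, 0 <= p x)%R ->
  (forall A, measurable A -> nu A = \int[mu]_(x in A) (p x)%:E) ->
  measurable_fun setT f -> (forall x, 0 <= f x) ->
  \int[nu]_x f x = \int[mu]_x (f x * (p x)%:E).
Proof.
move=> mp p0 nuE mf f0.
pose f_ := nnsfun_approx measurableT mf.
have fE x : f x = limn (fun n => (f_ n x)%:E).
  by apply/esym/cvg_lim => //; exact: cvg_nnsfun_approx.
have mEp : measurable_fun setT (EFin \o p) by exact/measurable_EFinP.
have mf_ n : measurable_fun setT (EFin \o f_ n) by exact/measurable_EFinP.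
transitivity (limn (fun n => \int[nu]_x (f_ n x)%:E)).
  rewrite -monotone_convergence//.
  - by apply: eq_integral => x _; rewrite fE.
  - by move=> n x _; rewrite lee_fin.
  - by move=> x _ m n mn; rewrite lee_fin; exact/lefP/nd_nnsfun_approx.
transitivity (limn (fun n => \int[mu]_x ((f_ n x)%:E * (p x)%:E))); last first.
  rewrite -monotone_convergence//.
  - apply: eq_integral => x _; apply/cvg_lim => //.
    apply: cvgeZr => //.
    exact: cvg_nnsfun_approx.
  - by move=> n; exact: (emeasurable_funM (mf_ n) mEp).
  - by move=> n x _; rewrite mule_ge0// lee_fin.
  - move=> x _ m n mn; rewrite lee_wpmul2r ?lee_fin//.
    exact/lefP/nd_nnsfun_approx.
congr (limn _); apply/funext => n.
rewrite integralT_nnsfun sintegralE.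
transitivity (\sum_(r \in range (f_ n))
    \int[mu]_x (r%:E * (\1_(f_ n @^-1` [set r]) x * p x)%:E)).
  apply: eq_fsbigr => r /[!inE] -[t _ <-].
  rewrite ge0_integralZl//; first last.
  - by rewrite lee_fin.
  - by move=> x _; rewrite lee_fin mulr_ge0.
  - by apply/measurable_EFinP; exact: measurable_funM.
  rewrite nuE; last exact: measurable_funPTI.
  congr (_ * _); rewrite integral_mkcond; apply: eq_integral => x _.
  rewrite patchE indicE; case: ifPn => _; first by rewrite mul1r.
  by rewrite mul0r.
rewrite -ge0_integral_fsum//; first last.
- move=> r x _; rewrite -EFinM lee_fin mulrA mulr_ge0//.
  rewrite indicE; have [|] := boolP (x \in _).
    by rewrite inE/= => <-; rewrite mulr1.
  by rewrite mulr0.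
- move=> r; apply: emeasurable_funM => //.
  by apply/measurable_EFinP; exact: measurable_funM.
apply: eq_integral => x _.
rewrite [in RHS]fimfunE -fsumEFin// ge0_mule_fsuml; last first.
  by move=> r; exact: nnfun_muleindic_ge0.
by apply: eq_fsbigr => r _; rewrite -!EFinM mulrA.
Qed.

(* The loss integrands are unconstrained, hence possibly not measurable, on the
   null event that K lies outside {1, ..., N}. *)
Lemma ge0_integral_full_set d (T : measurableType d) (R : realType)
    (mu : {measure set T -> \bar R}) (D : set T) (f : T -> \bar R) :
  measurable D -> mu (~` D) = 0 -> (forall x, 0 <= f x) ->
  \int[mu]_x f x = \int[mu]_(x in D) f x.
Proof.
move=> mD D0 f0; apply/eqP; rewrite eq_le; apply/andP; split.
  (* The integral of a non-negative function is a supremum over the simple functions below it, which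
     makes sense without measurability. Multiplying such an [h] by the indicator of [D] keeps its
     integral and puts it below [f] restricted to [D]. *)
  rewrite ge0_integralTE//; apply: ub_ereal_sup => _ [/= h hf <-].
  rewrite -integralT_nnsfun.
  rewrite -(setvU D) setUC ge0_integral_setU//; first last.
  - by apply/disj_setPS => x [? []].
  - by move=> x _; rewrite lee_fin.
  - by apply: measurable_funTS; exact/measurable_EFinP.
  - exact: measurableC.
  rewrite [X in _ + X]null_set_integral//; first last.
  - by apply: measurable_funTS; exact/measurable_EFinP.
  - exact: measurableC.
  rewrite adde0 integral_mkcond.
  pose g := [the {nnsfun T >-> R} of (h \* indic_nnsfun R mD)%R].
  rewrite [X in X <= _](_ : _ = sintegral mu g); last first.
    rewrite -integralT_nnsfun; apply: eq_integral => x _.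
    rewrite patchE /= mindicE; case: ifPn => _; rewrite ?mulr1 ?mulr0//.
  rewrite integral_mkcond ge0_integralTE; last first.
    by move=> x; rewrite patchE; case: ifPn.
  apply: ereal_sup_ubound; exists g => //= x.
  rewrite patchE mindicE; case: ifPn => _; rewrite ?mulr1 ?mulr0//.
rewrite integral_mkcond.
rewrite !ge0_integralTE//; last by move=> x; rewrite patchE; case: ifPn.
apply: le_ereal_sup => _ [/= h hf <-]; exists h => // x; apply: le_trans (hf x) _.
by rewrite patchE; case: ifPn.
Qed.

End integral_general.

(** * Independence as a product of laws *)

Section independence.
Local Open Scope ereal_scope.

(** Under [P] restricted to [E], the law of the pair is [r] times the product of the two laws: after
    division by [r] both measures agree on rectangles. Tonelli then gives the iterated integral. *)
Lemma ge0_integral_indep d (Omega : measurableType d) (R : realType)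
    (P : probability Omega R) d1 d2 (T1 : measurableType d1)
    (T2 : measurableType d2) (X : {RV P >-> T1}) (Y : {RV P >-> T2})
    (E : set Omega) (r : R) (G : T1 * T2 -> \bar R) :
  measurable E -> (0 < r)%R ->
  (forall A B, measurable A -> measurable B ->
     P (X @^-1` A `&` E `&` Y @^-1` B) =
     r%:E * (P (X @^-1` A) * P (Y @^-1` B))) ->
  measurable_fun setT G -> (forall z, 0 <= G z) ->
  \int[P]_(w in E) G (X w, Y w) =
  r%:E * \int[distribution P X]_x \int[distribution P Y]_y G (x, y).
Proof.
move=> mE r0 indep mG G0.
pose Z w := (X w, Y w).
have mZ : measurable_fun setT Z by apply: measurable_fun_pair.
pose nu : {measure set Omega -> \bar R} := mrestr P mE.
pose nuZ : {measure set (T1 * T2) -> \bar R} :=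
  measure_function_pushforward__canonical__measure_function_Measure nu mZ.
have ri0 : (0 <= r^-1)%R by rewrite invr_ge0 ltW.
pose m : {measure set (T1 * T2) -> \bar R} := mscale (NngNum ri0) nuZ.
have mE' A : measurable A -> (distribution P X \x distribution P Y) A = m A.
  apply: product_measure_unique => {}A B mA mB.
  rewrite /m /mscale /= /nuZ /pushforward /nu /mrestr /=.
  transitivity (r^-1%:E * P (X @^-1` A `&` E `&` Y @^-1` B)).
    congr (_ * P _).
    by apply/seteqP; split => w /=; rewrite /Z /=; tauto.
  by rewrite indep// muleA -EFinM mulVf ?gt_eqF// mul1e.
transitivity (\int[nuZ]_z G z).
  rewrite ge0_integral_pushforward//=.
  rewrite preimage_setT [RHS](ge0_integral_full_set _ _ _ _ E)//.
    apply: eq_measure_integral => A mA AE.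
    by rewrite /nu /= /mrestr setIidl.
  by rewrite /nu /= /mrestr setICl measure0.
have -> : \int[distribution P X]_x \int[distribution P Y]_y G (x, y) =
    \int[distribution P X \x distribution P Y]_z G z.
  by rewrite fubini_tonelli1.
rewrite [in RHS](eq_measure_integral m); last by move=> A mA _; exact: mE'.
rewrite ge0_integral_mscale//= muleA -EFinM mulfV ?mul1e// gt_eqF//.
Qed.

End independence.

(** * Affine substitution on the line *)

Section affine_change_of_variables.
Local Open Scope ereal_scope.
Context {R : realType}.

(** The image of Lebesgue measure under x -> c + s x, multiplied by s, gives half-open intervals
    their length, so it is Lebesgue measure by uniqueness. *)
Lemma ge0_integral_affine (c s : R) (f : R -> \bar R) : (0 < s)%R ->
  measurable_fun setT f -> (forall x, 0 <= f x) ->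
  \int[lebesgue_measure]_x f (c + s * x)%R =
  s^-1%:E * \int[lebesgue_measure]_x f x.
Proof.
move=> s0 mf f0.
pose g : R -> measurableTypeR R := fun x => (c + s * x)%R.
have mg : measurable_fun setT g.
  by apply: measurable_funD => //; exact: measurable_funM.
pose mu : {measure set (measurableTypeR R) -> \bar R} :=
  measure_function_pushforward__canonical__measure_function_Measure
    (@lebesgue_measure R) mg.
pose m : {measure set (measurableTypeR R) -> \bar R} :=
  mscale (NngNum (ltW s0)) mu.
have mE A : measurable A -> lebesgue_measure A = m A.
  apply: lebesgue_measure_unique => _ [[a b]] _ <-.
  rewrite /m /mscale /= /mu /pushforward /=.
  transitivity (s%:E * lebesgue_measure
      `]((a - c) / s)%R, ((b - c) / s)%R]%classic); last first.
    congr (_ * lebesgue_measure _); apply/seteqP; split => x /=;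
    by rewrite /g !in_itv/= ltr_pdivrMr// ler_pdivlMr// ltrBlDl lerBrDl
      (mulrC x).
  rewrite !lebesgue_measure_itv/= !lte_fin ltr_pM2r ?invr_gt0// ltrD2r.
  case: ifPn => _; last by rewrite mule0.
  by rewrite -EFinB -EFinD -EFinM; congr EFin; field; rewrite gt_eqF.
rewrite -[LHS](_ : \int[mu]_x f x = _); last first.
  by rewrite ge0_integral_pushforward.
rewrite [in RHS](eq_measure_integral m); last by move=> A mA _; exact: mE.
by rewrite ge0_integral_mscale//= muleA -EFinM mulVf ?gt_eqF// mul1e.
Qed.

End affine_change_of_variables.

(** * Lebesgue measure on row vectors *)

Section lebesgue_rV_theory.
Local Open Scope ereal_scope.
Context {R : realType}.

(** The two scalars cover the forward map, the noise map, differences and translates at once. *)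
Lemma measurable_rVD d (T : measurableType d) n (a b : R)
    (f g : T -> 'rV[R]_n) :
  measurable_fun setT f -> measurable_fun setT g ->
  measurable_fun setT (fun w => a *: f w + b *: g w)%R.
Proof.
move=> mf mg; apply: measurable_fun_rVP => i.
rewrite (_ : (fun _ => _) =
    fun w => (a * f w ord0 i + b * g w ord0 i)%R); last first.
  by apply/funext => w; rewrite !mxE.
apply: measurable_funD; apply: measurable_funM => //.
  exact: (measurableT_comp (@measurable_coord _ R n i) mf).
exact: (measurableT_comp (@measurable_coord _ R n i) mg).
Qed.

Lemma ge0_integral_lebesgue_rVS n (f : 'rV[R]_n.+1 -> \bar R) :
  measurable_fun setT f -> (forall x, 0 <= f x) ->
  \int[lebesgue_rV n.+1]_x f x =
  \int[lebesgue_measure]_x \int[lebesgue_rV n]_v f (cons_rV (x, v)).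
Proof.
move=> mf f0.
pose RT : measurableType _ := measurableTypeR R.
have mc : measurable_fun [set: (RT * 'rV[R]_n)%type] (@cons_rV R n).
  exact: measurable_cons_rV.
pose m : {measure set (RT * 'rV[R]_n) -> \bar R} :=
  (lebesgue_measure \x lebesgue_rV n)%E.
refine (eq_trans (@ge0_integral_pushforward _ _ (RT * 'rV[R]_n)%type _ R (@cons_rV R n)
  mc m setT f measurableT mf _) _) => //.
rewrite preimage_setT fubini_tonelli1//=.
by apply: measurableT_comp => //; exact: measurable_cons_rV.
Qed.

(** Induction on the dimension: the affine map acts separately on the first coordinate and on the
    others, so each coordinate split off by Tonelli contributes one factor 1 / s. *)
Lemma ge0_integral_affine_rV n (c : 'rV[R]_n) (s : R)
    (f : 'rV[R]_n -> \bar R) : (0 < s)%R ->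
  measurable_fun setT f -> (forall x, 0 <= f x) ->
  \int[lebesgue_rV n]_x f (c + s *: x)%R =
  (s ^- n)%:E * \int[lebesgue_rV n]_x f x.
Proof.
move=> s0; elim: n c f => [|n IH] c f mf f0.
  rewrite expr0 invr1 mul1e; apply: eq_integral => x _; congr f.
  by apply/rowP; case.
have maff m (b : 'rV[R]_m) :
    measurable_fun setT (fun x : 'rV[R]_m => b + s *: x)%R.
  rewrite (_ : (fun _ => _) = fun x => (1 *: b + s *: x)%R); last first.
    by apply/funext => x; rewrite scale1r.
  exact: measurable_rVD.
rewrite !ge0_integral_lebesgue_rVS//; last exact: (measurableT_comp mf (maff _ c)).
pose c' : 'rV[R]_n := \row_j c ord0 (lift ord0 j).
have affE x v : (c + s *: cons_rV (x, v) =
    cons_rV (c ord0 ord0 + s * x, c' + s *: v))%R.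
  apply/rowP => i; transitivity (c ord0 i + s * cons_rV (x, v) ord0 i)%R.
    by move: (cons_rV _) => y; rewrite !mxE.
  have [j ->|->] := unliftP ord0 i; last by rewrite !cons_rV_ord0.
  by rewrite !cons_rV_lift !mxE.
pose F x := \int[lebesgue_rV n]_v f (cons_rV (x, v)).
have mfc : measurable_fun setT (f \o @cons_rV R n).
  by apply: measurableT_comp => //; exact: measurable_cons_rV.
have mF : measurable_fun setT F.
  apply: (measurable_fun_fubini_tonelli_F (f \o @cons_rV R n)) => // z.
  exact: f0.
have F0 x : 0 <= F x by apply: integral_ge0.
transitivity (\int[lebesgue_measure]_x
    ((s ^- n)%:E * F (c ord0 ord0 + s * x)%R)).
  apply: eq_integral => x _; rewrite -(IH c').
  - by apply: eq_integral => v _; rewrite affE.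
  - apply: (measurableT_comp mfc).
    exact: measurable_pair1.
  - by move=> v.
have mFc : measurable_fun setT (fun x => F (c ord0 ord0 + s * x)%R).
  apply: (measurableT_comp mF).
  by apply: measurable_funD => //; exact: measurable_funM.
have k0 : 0 <= (s ^- n)%:E by rewrite lee_fin invr_ge0 exprn_ge0// ltW.
rewrite (@ge0_integralZl _ (measurableTypeR R) R lebesgue_measure setT
  measurableT _ mFc _ (fun x _ => F0 _) k0).
rewrite (ge0_integral_affine _ _ _ s0 mF F0) muleA -EFinM; congr (_%:E * _).
by rewrite exprSr invfM.
Qed.

End lebesgue_rV_theory.

(** * Comparison of continuous densities *)

Section densities.
Context {R : realType}.

(** A ball of the sup norm is a box with sides of length 2 r. Its positive volume lets a pointwise
    inequality between continuous densities be detected by integrals. *)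
Lemma lebesgue_rV_ball n (x : 'rV[R]_n) (r : R) : 0 < r ->
  let B := [set y : 'rV[R]_n | forall i, ball (x ord0 i) r (y ord0 i)] in
  measurable B /\ (0 < lebesgue_rV n B)%E.
Proof.
move=> r0 B; split.
  rewrite (_ : B = \bigcap_(i in [set: 'I_n])
      (fun y : 'rV[R]_n => y ord0 i) @^-1` ball (x ord0 i) r).
    apply: fin_bigcap_measurable => // i _.
    rewrite -[X in measurable X]setTI; apply: measurable_coord => //.
    exact: measurable_ball.
  by apply/seteqP; split=> y By i; [move=> _; exact: By|exact: By].
rewrite (@lebesgue_rV_box R n (fun i => ball (x ord0 i) r)); last first.
  by move=> i; exact: measurable_ball.
apply: (big_ind (fun z : \bar R => 0 < z)%E) => //.
- by move=> *; rewrite mule_gt0.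
- by move=> i _; rewrite lebesgue_measure_ball ?lte_fin ?mulrn_wgt0// ltW.
Qed.

(** If p1 exceeded p2 at x, continuity would give a gap of at least half the size on a small cube
    around x, and the two integrals over that cube would differ. *)
Lemma continuous_density_le n (p1 p2 : 'rV[R]_n -> R) :
  measurable_fun setT p1 -> measurable_fun setT p2 ->
  (forall x, 0 <= p1 x) -> (forall x, 0 <= p2 x) ->
  continuous p1 -> continuous p2 ->
  (\int[lebesgue_rV n]_x (p2 x)%:E < +oo)%E ->
  (forall A, measurable A -> \int[lebesgue_rV n]_(x in A) (p1 x)%:E =
     \int[lebesgue_rV n]_(x in A) (p2 x)%:E)%E ->
  forall x, p1 x <= p2 x.
Proof.
move=> mp1 mp2 p10 p20 cp1 cp2 p2oo p12 x; rewrite leNgt; apply/negP => ltp.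
pose e := (p1 x - p2 x) / 2.
have e0 : 0 < e by rewrite divr_gt0// subr_gt0.
have : \forall y \near x, e < p1 y - p2 y.
  have cB : p1 y - p2 y @[y --> x] --> p1 x - p2 x.
    exact: (cvgB (cp1 x) (cp2 x)).
  move/cvgr_gt : cB; apply.
  by rewrite /e ltr_pdivrMr// mulr_natr mulr2n ltrDl subr_gt0.
move=> /nbhs_ballP[r /= r0 rxB].
have [mB B0] := lebesgue_rV_ball n x r r0.
set B := [set y : 'rV[R]_n | _] in mB B0.
have Bge y : B y -> e + p2 y <= p1 y.
  move=> By; rewrite -lerBrDr ltW//; apply: rxB.
  by split => // i j; rewrite (ord1 i); exact: By.
have mEp1 : measurable_fun B (EFin \o p1).
  by apply: measurable_funTS; exact/measurable_EFinP.
have mEp2 : measurable_fun B (EFin \o p2).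
  by apply: measurable_funTS; exact/measurable_EFinP.
have := p12 _ mB; apply/eqP; rewrite gt_eqF//.
apply: (@lt_le_trans _ _ (\int[lebesgue_rV n]_(y in B) (e%:E + (p2 y)%:E))%E);
  last first.
  apply: ge0_le_integral => //.
  - by move=> y _; rewrite adde_ge0// lee_fin// ltW.
  - exact: (emeasurable_funD (measurable_cst _) mEp2).
have eE0 y : B y -> (0 <= e%:E)%E by rewrite lee_fin ltW.
rewrite ge0_integralD//; last by move=> y _; rewrite lee_fin.
(* The extra positive mass makes the inequality strict because the integral of [p2] over the cube is
   finite. *)
rewrite integral_cst// addeC lteDl ?mule_gt0// ge0_fin_numE; last first.
  by apply: integral_ge0 => y _; rewrite lee_fin.
apply: le_lt_trans p2oo; apply: ge0_subset_integral => //.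
  exact/measurable_EFinP.
by move=> y _; rewrite lee_fin.
Qed.

End densities.

(** * The standard Gaussian density *)

Section standard_gaussian.
Context {R : realType} {n : nat}.
Implicit Types u v : 'rV[R]_n.

Lemma norm2_sqr u : norm2 u ^+ 2 = \sum_i u ord0 i ^+ 2.
Proof. by rewrite sqr_sqrtr// sumr_ge0// => i _; rewrite sqr_ge0. Qed.

Lemma coord_sqr_le_norm2 u i : u ord0 i ^+ 2 <= norm2 u ^+ 2.
Proof.
rewrite norm2_sqr (bigD1 i)//= lerDl sumr_ge0// => j _; exact: sqr_ge0.
Qed.

Let phi u : R := gaussian_pdf 0 1 u.
Let c : R := normal_peak 1 ^+ n.

Lemma std_gaussianE u : phi u = c * expR (- (norm2 u ^+ 2 / 2)).
Proof. by rewrite /phi /gaussian_pdf subr0 expr1n mulNr. Qed.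

Let c_gt0 : 0 < c.
Proof. by rewrite exprn_gt0// normal_peak_gt0// oner_neq0. Qed.

Lemma std_gaussian_gt0 u : 0 < phi u.
Proof. by rewrite std_gaussianE mulr_gt0// expR_gt0. Qed.

Lemma std_gaussian_le u : phi u <= c.
Proof.
rewrite std_gaussianE ler_piMr//; first exact: ltW.
rewrite -[X in _ <= X]expR0 ler_expR oppr_le0.
by rewrite mulr_ge0// sqr_ge0.
Qed.

(** From 1 + y <= e^y at y = |u|^2 / 2, which bounds |u|^2 by 2 e^y. *)
Lemma coord_sqr_std_gaussian_le u i : u ord0 i ^+ 2 * phi u <= 2 * c.
Proof.
rewrite std_gaussianE mulrCA [2 * c]mulrC ler_pM2l// expRN.
rewrite ler_pdivrMr ?expR_gt0//.
have := expR_ge1Dx (norm2 u ^+ 2 / 2).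
have := coord_sqr_le_norm2 u i; lra.
Qed.

Lemma coord_std_gaussian_le u i : `|u ord0 i| * phi u <= 2 * c.
Proof.
have h1 := coord_sqr_std_gaussian_le u i; have h2 := std_gaussian_le u.
have p0 := std_gaussian_gt0 u.
(* Here |t| <= (1 + t^2) / 2 reduces the first moment to the bounds on [phi u] and on the second
   moment. *)
apply: (@le_trans _ _ ((1 + u ord0 i ^+ 2) / 2 * phi u)); last by nra.
rewrite ler_pM2r// -[u ord0 i ^+ 2]real_normK ?num_real//.
by have := sqr_ge0 (`|u ord0 i| - 1); nra.
Qed.

(* From 1 + y <= e^y at y = |u|^2 / 2 - |v|^2 / 2; the factors |u_i| thus
   produced are absorbed by [phi u]. *)
Lemma std_gaussian_sub_le u v (r : R) : 0 <= r <= 1 ->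
  (forall i, `|u ord0 i - v ord0 i| <= r) -> phi u - phi v <= (3 * c * r) *+ n.
Proof.
move=> /andP[r0 r1] uv.
have -> : phi v = phi u * expR (norm2 u ^+ 2 / 2 - norm2 v ^+ 2 / 2).
  rewrite !std_gaussianE -mulrA -expRD; congr (_ * expR _); ring.
have := expR_ge1Dx (norm2 u ^+ 2 / 2 - norm2 v ^+ 2 / 2).
rewrite -(ler_pM2l (std_gaussian_gt0 u)) => h.
apply: (@le_trans _ _ (phi u * ((norm2 v ^+ 2 - norm2 u ^+ 2) / 2))).
  by move: h; rewrite -/(phi u); lra.
rewrite !norm2_sqr -sumrB mulr_suml mulr_sumr.
apply: (@le_trans _ _ (\sum_(i < n) 3 * c * r)); last first.
  by rewrite sumr_const card_ord.
apply: ler_sum => i _.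
have := coord_std_gaussian_le u i; have := std_gaussian_le u.
have := std_gaussian_gt0 u; have := uv i; rewrite -/(phi u).
move: (phi u) (u ord0 i) (v ord0 i) => p a b ab p0 pc apc.
(* The difference of squares is expanded around a, so that only a p and p occur, both bounded by
   multiples of c. The quadratic remainder becomes linear in r because r <= 1. *)
have -> : p * ((b ^+ 2 - a ^+ 2) / 2) =
    (a * p) * (b - a) + p * (a - b) ^+ 2 / 2 by field.
have h1 : (a * p) * (b - a) <= 2 * c * r.
  apply: (le_trans (ler_norm _)); rewrite normrM normrM (gtr0_norm p0).
  by rewrite distrC in ab; apply: ler_pM => //; rewrite mulr_ge0// ltW.
have h2 : p * (a - b) ^+ 2 <= c * r.
  apply: ler_pM => //; [exact: ltW|exact: sqr_ge0|].
  rewrite -[(a - b) ^+ 2]real_normK ?num_real// expr2.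
  apply: (@le_trans _ _ (r * r)); last by rewrite ler_piMr.
  exact: ler_pM.
have cr0 : 0 <= c * r by rewrite mulr_ge0// ltW.
lra.
Qed.

Lemma measurable_norm2_sqr :
  measurable_fun setT (fun u : 'rV[R]_n => norm2 u ^+ 2).
Proof.
under eq_fun do rewrite norm2_sqr.
apply: measurable_sum => i; apply: measurable_funX.
exact: measurable_coord.
Qed.

Lemma measurable_norm2_sqrB d (T : measurableType d) (f g : T -> 'rV[R]_n) :
  measurable_fun setT f -> measurable_fun setT g ->
  measurable_fun setT (fun x => norm2 (f x - g x) ^+ 2).
Proof.
move=> mf mg; apply: (measurableT_comp measurable_norm2_sqr).
rewrite (_ : (fun _ => _) = fun x => (1 *: f x + (- 1) *: g x)).
  exact: measurable_rVD.
by apply/funext => x; rewrite scale1r scaleN1r.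
Qed.

Lemma measurable_std_gaussian : measurable_fun setT phi.
Proof.
rewrite (_ : phi = fun u => c * expR (- (norm2 u ^+ 2 / 2))); last first.
  by apply/funext => u; exact: std_gaussianE.
apply: measurable_funM => //; apply: measurableT_comp => //.
apply: measurableT_comp => //; apply: measurable_funM => //.
exact: measurable_norm2_sqr.
Qed.

End standard_gaussian.

(** * Weighted variances *)

Section weighted_variance.
Context d {T : measurableType d} {R : realType}.
Variables (mu : {measure set T -> \bar R}) (w v : T -> R).
Hypothesis iw : mu.-integrable setT (EFin \o w).
Hypothesis ivw : mu.-integrable setT (EFin \o (fun z => v z * w z)).
Hypothesis ivvw : mu.-integrable setT (EFin \o (fun z => v z ^+ 2 * w z)).

Let M0 := \int[mu]_z w z.
Let M1 := \int[mu]_z (v z * w z).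
Let M2 := \int[mu]_z (v z ^+ 2 * w z).

Lemma integral_sqr_dist_weight (c : R) :
  (\int[mu]_z ((c - v z) ^+ 2 * w z)%:E = (c ^+ 2 * M0 - 2 * c * M1 + M2)%:E)%E.
Proof.
have EM f : mu.-integrable setT (EFin \o f) ->
    (\int[mu]_z (f z)%:E = (\int[mu]_z f z)%:E)%E.
  by move=> fi; rewrite /Rintegral fineK//; exact: integrable_fin_num.
rewrite !(EFinD, EFinM, EFinN) -!EM//.
transitivity (\int[mu]_z ((c ^+ 2)%:E * (w z)%:E +
    (- (2 * c))%:E * (v z * w z)%:E + (v z ^+ 2 * w z)%:E))%E.
  by apply: eq_integral => z _; rewrite -!EFinM -!EFinD; congr EFin; ring.
have i1 := integrableZl measurableT (c ^+ 2) iw.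
have i2 := integrableZl measurableT (- (2 * c)) ivw.
have i12 := integrableD measurableT i1 i2.
rewrite (integralD measurableT i12 ivvw) (integralD measurableT i1 i2).
rewrite !integralZl//.
by rewrite !(EFinD, EFinM, EFinN) mulNe.
Qed.

(** The bias-variance identity for an unnormalised weight of mass M0, whose mean is M1 / M0. All
    three moments are finite, so it is an identity between real polynomials in [c]. *)
Lemma weighted_variance (c : R) : M0 != 0 ->
  (\int[mu]_z ((c - v z) ^+ 2 * w z)%:E =
  ((c - M1 / M0) ^+ 2 * M0)%:E + \int[mu]_z ((M1 / M0 - v z) ^+ 2 * w z)%:E)%E.
Proof.
move=> M00; rewrite !integral_sqr_dist_weight -EFinD; congr EFin.
by field.
Qed.

End weighted_variance.

(** * Derivatives along lines, and integrals over a probability *)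

Section derive_line.
Context {R : realType} {n : nat}.

(** Turns a directional derivative into a one-variable one, the form used for differentiation under
    the integral sign. *)
Lemma derive_line (f : 'rV[R]_n -> R) (x v : 'rV[R]_n) :
  'D_v f x = (fun h => f (h *: v + x))^`()%classic 0.
Proof.
rewrite derive1E /derive scale0r add0r.
by under [in RHS]eq_fun => h do rewrite /= addr0 [h%:A]mulr1.
Qed.

Lemma derive1_ln (F : R -> R) (a : R) : derivable F a 1 -> 0 < F a ->
  (fun h => ln (F h))^`()%classic a = F^`()%classic a / F a.
Proof.
move=> dF F0; have [dln dlnE] := is_derive1_ln F0.
by rewrite (derive1_comp dF dln) [in X in X * _]derive1E dlnE mulrC.
Qed.

End derive_line.

Lemma bounded_integrable d (T : measurableType d) (R : realType)
    (mu : probability T R) (f : T -> R) (C : R) :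
  measurable_fun setT f -> (forall x, `|f x| <= C) ->
  mu.-integrable setT (EFin \o f).
Proof.
move=> mf fC; apply: measurable_bounded_integrable => //.
  apply: (@le_lt_trans _ _ 1%E); first exact: probability_le1.
  exact: ltry.
exists C; split; first exact: num_real.
by move=> y Cy x _; exact: (le_trans (fC x) (ltW Cy)).
Qed.

(** A zero integral would force f = 0 almost everywhere, making the whole space a null set of a
    probability. *)
Lemma Rintegral_gt0 d (T : measurableType d) (R : realType)
    (mu : probability T R) (f : T -> R) :
  mu.-integrable setT (EFin \o f) -> (forall x, 0 < f x) ->
  0 < \int[mu]_x f x.
Proof.
move=> fi f0; rewrite lt_neqAle Rintegral_ge0 ?andbT; last first.
  by move=> x _; exact: ltW.
apply/eqP => /esym I0.
have mf := measurable_int _ fi.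
have : (\int[mu]_x `|(EFin \o f) x| = 0)%E.
  under eq_integral do rewrite /= ger0_norm ?ltW//.
  by rewrite -[LHS]fineK ?integrable_fin_num// -/(Rintegral _ _ _) I0.
move=> /(ae_eq_integral_abs mu measurableT mf) [N [mN N0 sN]].
have : mu setT = 0%E.
  apply: (subset_measure0 _ _ _ N0) => // x _; apply: sN => /= /(_ I) [] /eqP.
  by rewrite gt_eqF.
move=> T0; have := probability_setT mu; rewrite T0 => /esym/eqP.
by rewrite onee_eq0.
Qed.

Section std_gaussian_derivative.
Context {R : realType} {n : nat}.

(** Along a coordinate line the exponent is quadratic in h. The factor [t] is there to become 1 / s,
    the speed at which the noise moves with the state. *)
Lemma is_derive_std_gaussian (u : 'rV[R]_n) (i : 'I_n) (t h : R) :
  is_derive h 1 (fun h : R => gaussian_pdf 0 1 (u + (t * h) *: delta_mx ord0 i))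
    (- (t * (u ord0 i + t * h) *
        gaussian_pdf 0 1 (u + (t * h) *: delta_mx ord0 i))).
Proof.
have E k : norm2 (u + k *: delta_mx ord0 i) ^+ 2 =
    norm2 u ^+ 2 + 2 * k * u ord0 i + k ^+ 2.
  rewrite !norm2_sqr (bigD1 i)//= [in RHS](bigD1 i)//= !mxE !eqxx mulr1.
  rewrite (eq_bigr (fun j => u ord0 j ^+ 2)); first by ring.
  by move=> j /negbTE ji; rewrite !mxE ji andbF mulr0 addr0.
pose F k := - ((norm2 u ^+ 2 + 2 * (t * k) * u ord0 i + (t * k) ^+ 2) / 2).
have FE k : gaussian_pdf 0 1 (u + (t * k) *: delta_mx ord0 i) =
    normal_peak 1 ^+ n * expR (F k).
  by rewrite std_gaussianE E.
rewrite (_ : (fun _ => _) = fun k => normal_peak 1 ^+ n * expR (F k)); last first.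
  by apply/funext => k; exact: FE.
rewrite FE.
have dF : is_derive h 1 F (- (t * (u ord0 i + t * h))).
  (* Written as a polynomial in h, the exponent can be differentiated formally. *)
  pose p : {poly R} := (- (norm2 u ^+ 2 / 2))%:P + (- (t * u ord0 i)) *: 'X +
    (- (t ^+ 2 / 2)) *: 'X^2.
  have -> : F = horner p.
    by apply/funext => k; rewrite /p !hornerE /F /=; field.
  apply: is_derive_eq; rewrite /p !derivD !derivZ derivC derivX derivXn.
  by rewrite !hornerE /=; field.
have dE : is_derive h 1 (expR \o F) (expR (F h) * - (t * (u ord0 i + t * h))).
  by have := @is_derive1_comp R expR F h _ _ (is_derive_expR (F h)) dF.
have := is_deriveZ (normal_peak 1 ^+ n) dE.
move=> d; apply: (is_derive_eq d); rewrite /GRing.scale /=; ring.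
Qed.

End std_gaussian_derivative.

(** * Gaussian mixtures *)

Section gaussian_mixture.
Context {R : realType} {n : nat}.
Variables (mu : probability 'rV[R]_n R) (a s : R).
Hypothesis s_gt0 : 0 < s.
Implicit Types x z : 'rV[R]_n.

(* Think of x = a z + s e with z distributed as [mu] and e standard Gaussian:
   [noise x z] is e, [mix_kernel x] the density at x given z, [mix_density] the
   density of x, and [cond_noise] the conditional expectation of e given x. *)
Definition noise x z : 'rV[R]_n := s^-1 *: x + (- (s^-1 * a)) *: z.

Definition mix_kernel x z : R := s ^- n * gaussian_pdf 0 1 (noise x z).

Definition mix_density x : R := \int[mu]_z mix_kernel x z.

Definition mix_moment x i : R :=
  \int[mu]_z (noise x z ord0 i * mix_kernel x z).

Definition cond_noise x : 'rV[R]_n := \row_i (mix_moment x i / mix_density x).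

(** The peak value of the kernel. The bounds below are multiples of it, uniform in x and z, so all
    the integrands are integrable against any probability [mu]. *)
Let c : R := s ^- n * normal_peak 1 ^+ n.

Let sn_gt0 : 0 < s ^- n.
Proof. by rewrite invr_gt0 exprn_gt0. Qed.

Let c_ge0 : 0 <= c.
Proof. by rewrite mulr_ge0// ?(ltW sn_gt0)// exprn_ge0// normal_peak_ge0. Qed.

Lemma mix_kernel_gt0 x z : 0 < mix_kernel x z.
Proof. by rewrite mulr_gt0// std_gaussian_gt0. Qed.

Let mix_kernel_le x z : `|mix_kernel x z| <= c.
Proof.
by rewrite gtr0_norm ?mix_kernel_gt0// ler_pM2l// std_gaussian_le.
Qed.

Let mix_moment_le x z i : `|noise x z ord0 i * mix_kernel x z| <= 2 * c.
Proof.
rewrite normrM (gtr0_norm (mix_kernel_gt0 _ _)) /mix_kernel /c mulrCA.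
by rewrite [2 * _]mulrCA ler_pM2l// coord_std_gaussian_le.
Qed.

Let mix_moment2_le x z i : `|noise x z ord0 i ^+ 2 * mix_kernel x z| <= 2 * c.
Proof.
rewrite ger0_norm; last by rewrite mulr_ge0 ?sqr_ge0// ltW// mix_kernel_gt0.
by rewrite /mix_kernel /c mulrCA [2 * _]mulrCA ler_pM2l//
  coord_sqr_std_gaussian_le.
Qed.

Lemma measurable_noise :
  measurable_fun setT (fun p : 'rV[R]_n * 'rV[R]_n => noise p.1 p.2).
Proof. exact: measurable_rVD. Qed.

Lemma measurable_mix_kernel :
  measurable_fun setT (fun p : 'rV[R]_n * 'rV[R]_n => mix_kernel p.1 p.2).
Proof.
apply: measurable_funM => //.
exact: (measurableT_comp measurable_std_gaussian measurable_noise).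
Qed.

Let measurable_noise_coord i :
  measurable_fun setT (fun p : 'rV[R]_n * 'rV[R]_n => noise p.1 p.2 ord0 i).
Proof. exact: (measurableT_comp (@measurable_coord _ R n i) measurable_noise). Qed.

Let measurable_mix_kernelr x : measurable_fun setT (mix_kernel x).
Proof. exact: (measurableT_comp measurable_mix_kernel (measurable_pair1 x)). Qed.

Let measurable_noise_coordr x i :
  measurable_fun setT (fun z => noise x z ord0 i).
Proof.
exact: (measurableT_comp (measurable_noise_coord i) (measurable_pair1 x)).
Qed.

Lemma integrable_mix_kernel x :
  mu.-integrable setT (EFin \o mix_kernel x).
Proof. exact: (bounded_integrable _ _ _ _ _ c). Qed.

Let integrable_mix_moment x i : mu.-integrable setT
  (EFin \o (fun z => noise x z ord0 i * mix_kernel x z)).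
Proof.
apply: (bounded_integrable _ _ _ _ _ (2 * c)) => //.
exact: measurable_funM.
Qed.

Let integrable_mix_moment2 x i : mu.-integrable setT
  (EFin \o (fun z => noise x z ord0 i ^+ 2 * mix_kernel x z)).
Proof.
apply: (bounded_integrable _ _ _ _ _ (2 * c)) => //.
by apply: measurable_funM => //; exact: measurable_funX.
Qed.

Lemma mix_density_gt0 x : 0 < mix_density x.
Proof.
by apply: Rintegral_gt0; [exact: integrable_mix_kernel|exact: mix_kernel_gt0].
Qed.

Lemma measurable_mix_density : measurable_fun setT mix_density.
Proof.
have := measurable_fun_fubini_tonelli_F (m2 := mu)
  (fun p : 'rV[R]_n * 'rV[R]_n => (mix_kernel p.1 p.2)%:E).
move=> h; apply: (measurableT_comp (f := fine)) => //.
apply: h; first by apply/measurable_EFinP; exact: measurable_mix_kernel.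
by move=> p; rewrite lee_fin ltW// mix_kernel_gt0.
Qed.

(* The integrand has no constant sign, whence the shift by its bound. *)
Lemma measurable_mix_moment i : measurable_fun setT (mix_moment ^~ i).
Proof.
pose f (p : 'rV[R]_n * 'rV[R]_n) :=
  noise p.1 p.2 ord0 i * mix_kernel p.1 p.2 + 2 * c.
rewrite (_ : mix_moment ^~ i = fun x => \int[mu]_z f (x, z) - 2 * c).
  apply: measurable_funB => //.
  have := measurable_fun_fubini_tonelli_F (m2 := mu) (EFin \o f).
  move=> h; apply: (measurableT_comp (f := fine)) => //.
  apply: h.
    apply/measurable_EFinP; apply: measurable_funD => //.
    by apply: measurable_funM => //; exact: measurable_mix_kernel.
  move=> p /=; rewrite lee_fin -lerBlDr sub0r.
  by have := mix_moment_le p.1 p.2 i; rewrite ler_norml => /andP[].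
apply/funext => x.
have iC : mu.-integrable setT (EFin \o cst (2 * c)).
  apply: (bounded_integrable _ _ _ _ _ (2 * c)) => // z.
  by rewrite ger0_norm// mulr_ge0.
rewrite /f (RintegralD measurableT (integrable_mix_moment x i) iC).
rewrite Rintegral_cst//; have := probability_setT mu => /= ->.
by rewrite mulr1 addrK.
Qed.

Lemma measurable_cond_noise : measurable_fun setT cond_noise.
Proof.
apply: measurable_fun_rVP => i.
under eq_fun do rewrite mxE.
apply: measurable_funM; first exact: measurable_mix_moment.
(* The inverse is written through exp and ln, which are measurable; this is legitimate because the
   density is positive. *)
rewrite (_ : (fun _ => _) = fun x => expR (- ln (mix_density x))).
  apply: measurableT_comp => //; apply: measurableT_comp => //.
  exact: (measurableT_comp (@measurable_ln R) measurable_mix_density).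
by apply/funext => x; rewrite expRN lnK// posrE mix_density_gt0.
Qed.

(** [weighted_variance] summed over the coordinates: with weight [mix_kernel x], the vector
    [noise x z] has total mass [mix_density x] and mean [cond_noise x]. *)
Lemma mix_variance x (e : 'rV[R]_n) :
  (\int[mu]_z (norm2 (e - noise x z) ^+ 2 * mix_kernel x z)%:E =
  (norm2 (e - cond_noise x) ^+ 2 * mix_density x)%:E +
  \int[mu]_z (norm2 (cond_noise x - noise x z) ^+ 2 * mix_kernel x z)%:E)%E.
Proof.
have sumE v : (\int[mu]_z (norm2 (v - noise x z) ^+ 2 * mix_kernel x z)%:E =
    \sum_i \int[mu]_z
      ((v ord0 i - noise x z ord0 i) ^+ 2 * mix_kernel x z)%:E)%E.
  rewrite -ge0_integral_sum//; first last.
  - by move=> i z _; rewrite lee_fin mulr_ge0 ?sqr_ge0// ltW// mix_kernel_gt0.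
  - move=> i; apply/measurable_EFinP; apply: measurable_funM => //.
    by apply: measurable_funX; exact: measurable_funB.
  apply: eq_integral => z _; rewrite sumEFin norm2_sqr mulr_suml.
  by congr EFin; apply: eq_bigr => i _; rewrite !mxE.
rewrite !sumE norm2_sqr mulr_suml -sumEFin -big_split/=.
apply: eq_bigr => i _; rewrite !mxE; apply: weighted_variance.
- exact: integrable_mix_kernel.
- exact: integrable_mix_moment.
- exact: integrable_mix_moment2.
- by rewrite gt_eqF// mix_density_gt0.
Qed.

(** Moving the state by at most s r in each coordinate moves the noise by at most r, whatever z is,
    so the modulus of continuity of the Gaussian passes through the integral. *)
Let mix_density_sub_le (x y : 'rV[R]_n) (r : R) : 0 <= r <= 1 ->
  (forall i, `|x ord0 i - y ord0 i| <= s * r) ->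
  mix_density x <= mix_density y + (3 * c * r) *+ n.
Proof.
move=> r01 xy; set k := _ *+ n.
have ik : mu.-integrable setT (EFin \o cst k).
  by apply: (bounded_integrable _ _ _ _ _ `|k|).
have -> : mix_density y + k = \int[mu]_z (mix_kernel y z + k).
  rewrite (RintegralD measurableT (integrable_mix_kernel y) ik).
  by rewrite Rintegral_cst//; have := probability_setT mu => /= ->; rewrite mulr1.
apply: le_Rintegral => //.
- exact: integrable_mix_kernel.
- exact: (integrableD measurableT (integrable_mix_kernel y) ik).
- move=> z _; rewrite -lerBlDl /mix_kernel -mulrBr.
  rewrite (_ : k = s ^- n * ((3 * normal_peak 1 ^+ n * r) *+ n)).
    rewrite ler_pM2l//; apply: std_gaussian_sub_le => // i.
    rewrite !mxE opprD addrACA subrr addr0 -mulrBr normrM gtr0_norm ?invr_gt0//.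
    by rewrite ler_pdivrMl.
  by rewrite /k /c mulrnAr; congr (_ *+ _); ring.
Qed.

Lemma continuous_mix_density : continuous mix_density.
Proof.
move=> x; have Fx : Filter (nbhs x) by typeclasses eauto.
apply/(@cvgrPdist_le _ _ _ (nbhs x) Fx mix_density) => e e0.
pose k := (3 * c) *+ n.
have k0 : 0 <= k by rewrite mulrn_wge0// mulr_ge0.
(* The minimum with 1 meets the restriction r <= 1, and [k + 1] keeps the denominator positive when
   n = 0. *)
pose r := Num.min 1 (e / (k + 1)).
have r0 : 0 < r by rewrite lt_min ltr01 divr_gt0// ltr_wpDl.
have r01 : 0 <= r <= 1 by rewrite ltW//= ge_min lexx.
have kr : (3 * c * r) *+ n <= e.
  rewrite -mulrnAl -/k; apply: (@le_trans _ _ (k * (e / (k + 1)))).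
    by apply: ler_wpM2l => //; rewrite ge_min lexx orbT.
  rewrite mulrCA ler_piMr ?(ltW e0)// ler_pdivrMr ?ltr_wpDl// mul1r.
  by rewrite lerDl.
apply/nbhs_ballP; exists (s * r) => /=; first exact: mulr_gt0.
move=> y [_ xy]; have {}xy i : `|x ord0 i - y ord0 i| <= s * r.
  exact/ltW/xy.
have yx i : `|y ord0 i - x ord0 i| <= s * r by rewrite distrC.
have h1 := mix_density_sub_le x y r r01 xy.
have h2 := mix_density_sub_le y x r r01 yx.
rewrite ler_distl lerBlDr; apply/andP; split.
  by rewrite (le_trans h2)// lerD2l.
by rewrite (le_trans h1)// lerD2l.
Qed.

Let noise_line x z i (h : R) : noise (h *: delta_mx ord0 i + x) z =
  noise x z + (s^-1 * h) *: delta_mx ord0 i.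
Proof. by rewrite /noise scalerDr scalerA -addrA addrC. Qed.

(** Differentiation under the integral on ]-1, 1[; each derivative of the kernel is - s^-1 times the
    integrand of [mix_moment]. *)
Lemma derive_mix_density x i :
  let F h := mix_density (h *: delta_mx ord0 i + x) in
  derivable F 0 1 /\ F^`()%classic 0 = - (s^-1 * mix_moment x i).
Proof.
move=> F.
pose f h z := mix_kernel (h *: delta_mx ord0 i + x) z.
pose df h z := - (s^-1 * (noise (h *: delta_mx ord0 i + x) z ord0 i *
  mix_kernel (h *: delta_mx ord0 i + x) z)).
have fdf (h : R) z : is_derive h 1 (f ^~ z) (df h z).
  have := is_deriveZ (s ^- n) (is_derive_std_gaussian (noise x z) i s^-1 h).
  rewrite (_ : _ \*: _ = f ^~ z); last first.
    by apply/funext => k; rewrite /f /mix_kernel noise_line.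
  move=> D; apply: (is_derive_eq D).
  rewrite /df /mix_kernel noise_line !mxE !eqxx /GRing.scale /= mulr1; ring.
have d1f (h : R) z : partial1of2 f h z = df h z.
  by rewrite partial1of2E; have [] := fdf h z.
have I0 : `]-1, 1[%classic (0 : R) by rewrite /= in_itv /= ltrN10 ltr01.
have fi (h : R) : `]-1, 1[%classic h -> mu.-integrable setT (EFin \o f h).
  by move=> _; exact: integrable_mix_kernel.
have fd (h : R) z : `]-1, 1[%classic h -> setT z -> derivable (f ^~ z) h 1.
  by move=> _ _; have [] := fdf h z.
(* The moment bound is uniform in h and z, so a constant dominates the derivatives. *)
pose G := cst (s^-1 * (2 * c)) : 'rV[R]_n -> R.
have G0 z : 0 <= G z by rewrite /G /= mulr_ge0 ?invr_ge0 ?(ltW s_gt0)// mulr_ge0.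
have iG : mu.-integrable setT (EFin \o G).
  by apply: (bounded_integrable _ _ _ _ _ (s^-1 * (2 * c))) => // z; rewrite ger0_norm.
have GM (h : R) z : `]-1, 1[%classic h -> setT z -> `|partial1of2 f h z| <= G z.
  move=> _ _; rewrite d1f /df normrN normrM ger0_norm ?invr_ge0 ?(ltW s_gt0)//.
  by rewrite ler_pM2l ?invr_gt0.
split; first exact: (derivable_under_integral measurableT I0 fi fd G0 iG GM).
rewrite (differentiation_under_integral measurableT I0 fi fd G0 iG GM).
under eq_Rintegral do rewrite d1f /df scale0r add0r -mulNr.
by rewrite RintegralZl// mulNr.
Qed.

(** Tweedie's formula: dividing the derivative of the density by the density produces the
    conditional mean of the noise. *)
Lemma gradient_ln_mix_density x :
  gradient (fun y => ln (mix_density y)) x = - (s^-1 *: cond_noise x).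
Proof.
apply/rowP => i; rewrite !mxE derive_line.
have [dF FE] := derive_mix_density x i.
by rewrite derive1_ln// ?FE scale0r add0r ?mix_density_gt0// mulNr mulrA.
Qed.

End gaussian_mixture.

(** * The joint law of the forward variable and the noise *)

Section forward_law.
Local Open Scope ereal_scope.
Context {R : realType} {n : nat} {d} {Omega : measurableType d}.
Variables (P : probability Omega R) (X0 eps : {RV P >-> 'rV[R]_n}).
Variables (E : set Omega) (r a s : R).
(* [E] is the event K = k, with r = 1 / N, or the whole space, with r = 1. *)
Hypothesis mE : measurable E.
Hypothesis r_gt0 : (0 < r)%R.
Hypothesis indep : forall A B, measurable A -> measurable B ->
  P (X0 @^-1` A `&` E `&` eps @^-1` B) =
  r%:E * (P (X0 @^-1` A) * P (eps @^-1` B)).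
Hypothesis heps : has_density P eps (gaussian_pdf 0 1).
Hypothesis s_gt0 : (0 < s)%R.

Let law0 : probability 'rV[R]_n R := distribution P X0.
Let X w := (a *: X0 w + s *: eps w)%R.

(* Tonelli, after substituting e = (x - a z) / s in the integral over the noise. *)
Lemma ge0_integral_forward (G : 'rV[R]_n * 'rV[R]_n -> \bar R) :
  measurable_fun setT G -> (forall p, 0 <= G p) ->
  \int[P]_(w in E) G (X w, eps w) =
  r%:E * \int[lebesgue_rV n]_x \int[law0]_z
    (G (x, noise a s x z) * (mix_kernel a s x z)%:E).
Proof.
move=> mG G0.
pose H (p : 'rV[R]_n * 'rV[R]_n) := G ((a *: p.1 + s *: p.2)%R, p.2).
have mH : measurable_fun setT H.
  apply: (measurableT_comp mG); apply: measurable_fun_pair => //.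
  exact: measurable_rVD.
have H0 p : 0 <= H p by exact: G0.
have -> : \int[P]_(w in E) G (X w, eps w) =
    \int[P]_(w in E) H (X0 w, eps w) by [].
rewrite (ge0_integral_indep _ _ _ P _ _ _ _ X0 eps E r H mE r_gt0 indep mH H0).
congr (_ * _).
have [mphi phi0 phiE] := heps.
pose W (p : 'rV[R]_n * 'rV[R]_n) :=
  G (p.1, noise a s p.1 p.2) * (mix_kernel a s p.1 p.2)%:E.
have mW : measurable_fun setT W.
  apply: emeasurable_funM; last first.
    by apply/measurable_EFinP; exact: measurable_mix_kernel.
  apply: (measurableT_comp mG); apply: measurable_fun_pair => //.
  exact: measurable_noise.
have W0 p : 0 <= W p.
  by rewrite mule_ge0// lee_fin ltW// mix_kernel_gt0.
(* With z outermost, the substitution can be made for each fixed z. *)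
rewrite (@fubini_tonelli _ _ _ _ _ (lebesgue_rV n) law0 W mW W0).
apply: eq_integral => z _.
have mHz : measurable_fun setT (fun e => H (z, e)).
  exact: (measurableT_comp mH (measurable_pair1 z)).
rewrite (ge0_integral_density _ _ _ (distribution P eps) (lebesgue_rV n)
  (gaussian_pdf 0 1) (fun e => H (z, e)) mphi phi0 phiE mHz (fun e => H0 _)).
pose h e := H (z, e) * (gaussian_pdf 0 1 e)%:E.
have mh : measurable_fun setT h.
  by apply: emeasurable_funM => //; exact/measurable_EFinP.
have h0 e : 0 <= h e by rewrite mule_ge0// lee_fin.
(* The affine map x -> s^-1 x - (s^-1 a) z is the noise as a function of the state; its Jacobian
   s^-n is the prefactor of [mix_kernel]. *)
have := ge0_integral_affine_rV n (- (s^-1 * a) *: z)%R s^-1 h.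
rewrite invr_gt0 => /(_ s_gt0 mh h0).
move=> /(congr1 (fun y => (s ^- n)%:E * y)).
rewrite exprVn invrK muleA -EFinM mulVf ?mul1e; last first.
  by rewrite expf_neq0// gt_eqF.
move=> <-; rewrite -ge0_integralZl//; first last.
- by rewrite lee_fin invr_ge0 exprn_ge0// ltW.
- apply: (measurableT_comp mh).
  rewrite (_ : (fun _ => _) =
    fun x => (1 *: (- (s^-1 * a) *: z) + s^-1 *: x)%R).
    exact: measurable_rVD.
  by apply/funext => x; rewrite scale1r.
apply: eq_integral => x _.
rewrite /h /H /W /mix_kernel /= [X in gaussian_pdf 0 1 X](_ : _ = noise a s x z);
  last by rewrite addrC.
rewrite muleCA EFinM; congr (G (_, _) * _); last by rewrite addrC.
rewrite scalerDr !scalerA mulrN mulrA divff ?gt_eqF// mul1r scaleNr addrA subrr.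
by rewrite add0r scale1r.
Qed.

(** When the integrand depends on the state only, the inner integral over z collapses to the mixture
    density. *)
Lemma ge0_integral_forward_state (g : 'rV[R]_n -> R) :
  measurable_fun setT g -> (forall x, 0 <= g x)%R ->
  \int[P]_(w in E) (g (X w))%:E =
  r%:E * \int[lebesgue_rV n]_x (g x * mix_density law0 a s x)%:E.
Proof.
move=> mg g0; pose G (p : 'rV[R]_n * 'rV[R]_n) := (g p.1)%:E.
have mG : measurable_fun setT G.
  by apply/measurable_EFinP; exact: measurableT_comp.
have G0 p : 0 <= G p by rewrite lee_fin.
rewrite (ge0_integral_forward G mG G0).
congr (_ * _); apply: eq_integral => x _ /=.
have ik := integrable_mix_kernel law0 a s s_gt0 x.
rewrite -[LHS]/(\int[law0]_z ((g x)%:E * (EFin \o mix_kernel a s x) z)).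
by rewrite integralZl// EFinM /mix_density /Rintegral fineK// integrable_fin_num.
Qed.

End forward_law.

Section noise_energy.
Local Open Scope ereal_scope.
Context {R : realType} {n : nat} {d} {Omega : measurableType d}.
Variables (P : probability Omega R) (eps : {RV P >-> 'rV[R]_n}).
Hypothesis heps : has_density P eps (gaussian_pdf 0 1).

(* |u|^2 phi(u) <= 4 phi(u / 2), and phi(u / 2) is integrable by rescaling. *)
Lemma noise_energy_lty : \int[P]_w (norm2 (eps w) ^+ 2)%:E < +oo.
Proof.
have [mphi phi0 phiE] := heps.
have mN : measurable_fun setT (fun u : 'rV[R]_n => (norm2 u ^+ 2)%:E).
  by apply/measurable_EFinP; exact: measurable_norm2_sqr.
have N0 (u : 'rV[R]_n) : 0 <= (norm2 u ^+ 2)%:E by rewrite lee_fin sqr_ge0.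
rewrite -[ltLHS]/(\int[P]_w ((fun u : 'rV[R]_n => (norm2 u ^+ 2)%:E) \o eps) w).
rewrite -ge0_integral_distribution//.
rewrite (ge0_integral_density _ _ _ (distribution P eps) (lebesgue_rV n)
  (gaussian_pdf 0 1) _ mphi phi0 phiE mN N0).
have mEphi : measurable_fun setT
    (fun u : 'rV[R]_n => (gaussian_pdf 0 1 u : R)%:E).
  exact/measurable_EFinP.
have phi0E (u : 'rV[R]_n) : 0 <= (gaussian_pdf 0 1 u : R)%:E by rewrite lee_fin.
have h0 : (0 < 2^-1 :> R)%R by rewrite invr_gt0.
have := ge0_integral_affine_rV n 0%R 2^-1 _ h0 mEphi phi0E.
rewrite -phiE// preimage_setT probability_setT mule1 => phi2.
have mphi2 : measurable_fun setT
    (fun u : 'rV[R]_n => (gaussian_pdf 0 1 (0 + 2^-1 *: u)%R : R)%:E).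
  apply/measurable_EFinP; apply: (measurableT_comp mphi).
  rewrite (_ : (fun _ => _) = fun u : 'rV[R]_n => (0 *: u + 2^-1 *: u)%R).
    exact: measurable_rVD.
  by apply/funext => u; rewrite scale0r.
have I4 := @ge0_integralZl _ _ R (lebesgue_rV n) setT measurableT _ mphi2 4%:E
  (fun u _ => phi0E _) ltac:(by rewrite lee_fin).
apply: (@le_lt_trans _ _ (4%:E * (2^-1 ^- n)%:E)); last by rewrite -EFinM ltry.
move: phi2 => /= <-; rewrite -I4.
apply: ge0_le_integral => //.
- by move=> u _; rewrite mule_ge0.
- exact: emeasurable_funM.
- exact: emeasurable_funM.
move=> u _; rewrite -!EFinM lee_fin add0r !std_gaussianE.
have -> : (norm2 (2^-1 *: u) ^+ 2 = norm2 u ^+ 2 / 4)%R.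
  rewrite !norm2_sqr mulr_suml; apply: eq_bigr => i _.
  by rewrite !mxE; field.
set S := (norm2 u ^+ 2)%R; have S0 : (0 <= S)%R by exact: sqr_ge0.
rewrite [X in (X <= _)%R]mulrCA [X in (_ <= X)%R]mulrCA.
rewrite ler_wpM2l ?exprn_ge0 ?normal_peak_ge0//.
(* One part of the exponent is that of phi(u / 2); the remaining 3 S / 8 absorbs S, since S <= 4 (1
   + 3 S / 8). *)
have -> : (- (S / 2) = - (S * (3 / 8)) + - (S / 4 / 2))%R by field.
rewrite expRD mulrA ler_pM2r ?expR_gt0// expRN ler_pdivrMr ?expR_gt0//.
by have := expR_ge1Dx (S * (3 / 8)); lra.
Qed.

End noise_energy.

(** * Splitting an expectation over the step index *)

Section uniform_split.
Local Open Scope ereal_scope.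
Context {R : realType} {d} {Omega : measurableType d}.
Variables (P : probability Omega R) (K : {RV P >-> nat}) (N : nat).
Hypothesis hK : uniform_on_1_to P N K.

Lemma ge0_integral_uniform (F : nat -> Omega -> \bar R) :
  (forall k, (1 <= k <= N)%N -> measurable_fun setT (F k)) ->
  (forall k w, 0 <= F k w) ->
  \int[P]_w F (K w) w =
  \sum_(k <- iota 1 N) \int[P]_(w in K @^-1` [set k]) F k w.
Proof.
move=> mF F0.
pose E k := K @^-1` [set k].
have mE k : measurable (E k).
  by rewrite -[E k]setTI; exact: (measurable_funP K).
have iotaE k : (k \in iota 1 N) = (1 <= k <= N)%N by rewrite mem_iota add1n ltnS.
pose D := \big[setU/set0]_(k <- iota 1 N) E k.
have DE : D = \bigcup_(k in [set` iota 1 N]) E k by rewrite bigcup_seq.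
have mD : measurable D by apply: bigsetU_measurable => k _; exact: mE.
have PD : P (~` D) = 0.
  (* The complement of [D] is covered by countably many null events, one for each value of K outside
     {1, ..., N}. *)
  pose B k := if (1 <= k <= N)%N then set0 else E k.
  have BN : P.-negligible (\bigcup_k B k).
    apply: negligible_bigcup => k; rewrite /B; case: ifPn => kN.
      exact: negligible_set0.
    apply/negligibleP; first exact: mE.
    by have := hK k; rewrite (negbTE kN).
  apply/negligibleP; first exact: measurableC.
  apply: negligibleS BN => w /= Dw; exists (K w) => //=; rewrite /B; case: ifPn => //.
  by move=> KN; exfalso; apply: Dw; rewrite DE; exists (K w) => //=; rewrite iotaE.
rewrite (ge0_integral_full_set _ _ _ P D)// ge0_integral_bigsetU//.
- apply: eq_bigr => k _; apply: eq_integral => w; rewrite inE => Kw.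
  by rewrite -[k in RHS]Kw.
- exact: iota_uniq.
- by move=> i j _ _ [w [/= Ei Ej]]; rewrite -Ei -Ej.
- rewrite -/D DE bigcup_mkcond; apply/measurable_fun_bigcup.
    by move=> k; case: ifPn.
  move=> k; case: ifPn => [|_]; last exact: measurable_fun_set0.
  rewrite inE /= iotaE => kN.
  apply: (eq_measurable_fun (F k)); last exact: measurable_funTS (mF _ kN).
  by move=> w; rewrite inE => Kw; rewrite -[k in LHS]Kw.
Qed.

End uniform_split.

(** * Denoising *)

Section denoising.
Local Open Scope ereal_scope.
Context {R : realType} {n : nat} {d} {Omega : measurableType d}.
Variables (P : probability Omega R) (X0 eps : {RV P >-> 'rV[R]_n}).
Variables (E : set Omega) (r a s : R).
Hypothesis mE : measurable E.
Hypothesis r_gt0 : (0 < r)%R.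
Hypothesis indep : forall A B, measurable A -> measurable B ->
  P (X0 @^-1` A `&` E `&` eps @^-1` B) =
  r%:E * (P (X0 @^-1` A) * P (eps @^-1` B)).
Hypothesis heps : has_density P eps (gaussian_pdf 0 1).
Hypothesis s_gt0 : (0 < s)%R.

Let law0 : probability 'rV[R]_n R := distribution P X0.
Let X w := (a *: X0 w + s *: eps w)%R.
Let m := cond_noise law0 a s.

(** This is E|m(X) - eps|^2 written through the kernel, the part of the loss that no predictor can
    remove. *)
Definition residual_variance : \bar R :=
  \int[lebesgue_rV n]_x \int[law0]_z
    (norm2 (m x - noise a s x z) ^+ 2 * mix_kernel a s x z)%:E.

Lemma residual_variance_ge0 : 0 <= residual_variance.
Proof.
apply: integral_ge0 => x _; apply: integral_ge0 => z _.
by rewrite lee_fin mulr_ge0 ?sqr_ge0// ltW// mix_kernel_gt0.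
Qed.

(** [mix_variance] at e = f(x), integrated over x. Every term is non-negative, so the sum splits in
    [0, +oo]. *)
Lemma denoising_decomposition (f : 'rV[R]_n -> 'rV[R]_n) :
  measurable_fun setT f ->
  \int[P]_(w in E) (norm2 (f (X w) - eps w) ^+ 2)%:E =
  \int[P]_(w in E) (norm2 (f (X w) - m (X w)) ^+ 2)%:E +
  r%:E * residual_variance.
Proof.
move=> mf.
have mm : measurable_fun setT m by exact: measurable_cond_noise.
pose V (p : 'rV[R]_n * 'rV[R]_n) :=
  (norm2 (m p.1 - noise a s p.1 p.2) ^+ 2 * mix_kernel a s p.1 p.2)%:E.
have mV : measurable_fun setT V.
  apply/measurable_EFinP; apply: measurable_funM.
    apply: measurable_norm2_sqrB; last exact: measurable_noise.
    exact: measurableT_comp.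
  exact: measurable_mix_kernel.
have V0 p : 0 <= V p.
  by rewrite lee_fin mulr_ge0 ?sqr_ge0// ltW// mix_kernel_gt0.
pose G (p : 'rV[R]_n * 'rV[R]_n) := (norm2 (f p.1 - p.2) ^+ 2)%:E.
have mG : measurable_fun setT G.
  apply/measurable_EFinP; apply: measurable_norm2_sqrB => //.
  exact: measurableT_comp.
have G0 p : 0 <= G p by rewrite lee_fin sqr_ge0.
have mg : measurable_fun setT (fun x => norm2 (f x - m x) ^+ 2)%R.
  exact: measurable_norm2_sqrB.
have M0 := mix_density_gt0 law0 a s s_gt0.
rewrite -[LHS]/(\int[P]_(w in E) G (X w, eps w)).
rewrite (ge0_integral_forward P X0 eps E r a s mE r_gt0 indep heps s_gt0 G mG G0).
rewrite (ge0_integral_forward_state P X0 eps E r a s mE r_gt0 indep heps s_gt0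
  _ mg (fun x => sqr_ge0 _)).
rewrite -/law0 -ge0_muleDr; last 2 first.
- by apply: integral_ge0 => x _; rewrite lee_fin mulr_ge0 ?sqr_ge0// ltW.
- exact: residual_variance_ge0.
congr (_ * _).
have mA : measurable_fun setT
    (fun x => (norm2 (f x - m x) ^+ 2 * mix_density law0 a s x)%:E).
  apply/measurable_EFinP; apply: measurable_funM => //.
  exact: measurable_mix_density.
have A0 x : 0 <= (norm2 (f x - m x) ^+ 2 * mix_density law0 a s x)%:E.
  by rewrite lee_fin mulr_ge0 ?sqr_ge0// ltW.
have mB := measurable_fun_fubini_tonelli_F (m2 := law0) V mV V0.
have B0 x : 0 <= \int[law0]_z V (x, z) by apply: integral_ge0.
rewrite -[residual_variance]/(\int[lebesgue_rV n]_x \int[law0]_z V (x, z)).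
transitivity (\int[lebesgue_rV n]_x
    ((norm2 (f x - m x) ^+ 2 * mix_density law0 a s x)%:E +
     \int[law0]_z V (x, z))); last first.
  exact: (ge0_integralD _ measurableT (fun x _ => A0 x) mA (fun x _ => B0 x) mB).
apply: eq_integral => x _.
rewrite -(mix_variance law0 a s s_gt0 x (f x)).
by apply: eq_integral => z _; rewrite [RHS]EFinM.
Qed.

(** The decomposition with the zero predictor bounds r times this quantity by E|eps|^2, and r >
    0. *)
Lemma residual_variance_lty : residual_variance < +oo.
Proof.
have : r%:E * residual_variance < +oo.
  have f0 : measurable_fun setT (fun _ : 'rV[R]_n => 0%R : 'rV[R]_n).
    exact: measurable_cst.
  have e0 : \int[P]_(w in E) (norm2 (0 - eps w)%R ^+ 2)%:E < +oo.
    apply: le_lt_trans (noise_energy_lty P eps heps).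
    rewrite (eq_integral (fun w => (norm2 (eps w) ^+ 2)%:E)); last first.
      move=> w _; rewrite sub0r !norm2_sqr; congr EFin.
      by apply: eq_bigr => i _; rewrite mxE sqrrN.
    apply: ge0_subset_integral => //.
      apply/measurable_EFinP; apply: (measurableT_comp measurable_norm2_sqr).
      exact: (measurable_funP eps).
    by move=> w _; rewrite lee_fin sqr_ge0.
  apply: le_lt_trans e0; rewrite (denoising_decomposition _ f0) leeDr//.
  by apply: integral_ge0 => w _; rewrite lee_fin sqr_ge0.
move=> rv; rewrite ltey; apply/negP => /eqP vy.
by move: rv; rewrite vy gt0_muley ?lte_fin.
Qed.

End denoising.

Lemma alpha_bar_lt1 (R : realType) (b : nat -> R) (N k : nat) :
  (forall i : nat, (1 <= i <= N)%N -> 0 < b i < 1) -> (1 <= k <= N)%N ->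
  0 < 1 - alpha_bar b k.
Proof.
move=> hb; rewrite subr_gt0.
(* The invariant is [<= 1] because the empty product equals 1; each factor 1 - b_i then makes the
   bound strict. *)
have [_ ab] : 0 < alpha_bar b 0 <= 1 /\ forall j, (j < N)%N ->
    0 < alpha_bar b j.+1 < 1.
  have a0 : 0 < alpha_bar b 0 <= 1 by rewrite /alpha_bar big_geq// ltr01 lexx.
  split=> //; suff ab j : (j < N)%N ->
      0 < alpha_bar b j <= 1 -> 0 < alpha_bar b j.+1 < 1.
    elim=> [|j IH] jN; first exact: ab.
    by apply: ab => //; have /andP[-> /ltW ->] := IH (ltnW jN).
  move=> jN /andP[aj0 aj1]; rewrite /alpha_bar big_nat_recr//= -/(alpha_bar b j).
  have /andP[bj0 bj1] := hb j.+1 jN.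
  apply/andP; split; first by rewrite mulr_gt0// subr_gt0.
  by apply: (@le_lt_trans _ _ (1 - b j.+1)); [rewrite ler_piMl// subr_ge0 ltW|lra].
by case: k => // k kN; have /andP[] := ab k kN.
Qed.

(** * The marginal density of the chain *)

Section identify_density.
Context {R : realType} {n : nat} {d} {Omega : measurableType d}.
Variables (P : probability Omega R) (X0 eps : {RV P >-> 'rV[R]_n}).
Variables (a s : R) (q : 'rV[R]_n -> R).
Hypothesis indep : forall A B, measurable A -> measurable B ->
  P (X0 @^-1` A `&` eps @^-1` B) = (P (X0 @^-1` A) * P (eps @^-1` B))%E.
Hypothesis heps : has_density P eps (gaussian_pdf 0 1).
Hypothesis s_gt0 : 0 < s.

(** Both functions are continuous densities of one law, so comparison in both directions gives
    equality everywhere. Almost-everywhere equality would not determine the pointwise gradient of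
    the score. *)
Lemma density_forwardE :
  has_density P (fun w => a *: X0 w + s *: eps w) q -> continuous q ->
  q = mix_density (distribution P X0) a s.
Proof.
move=> [mq q0 qE] cq; set law0 : probability _ _ := distribution P X0.
have indepT A B : measurable A -> measurable B ->
    P (X0 @^-1` A `&` setT `&` eps @^-1` B) =
    (1%:E * (P (X0 @^-1` A) * P (eps @^-1` B)))%E.
  by move=> mA mB; rewrite setIT mul1e; exact: indep.
have mM := measurable_mix_density law0 a s s_gt0.
have M0 x : 0 <= mix_density law0 a s x by exact/ltW/mix_density_gt0.
have qM A : measurable A -> (\int[lebesgue_rV n]_(x in A) (q x)%:E =
    \int[lebesgue_rV n]_(x in A) (mix_density law0 a s x)%:E)%E.
  move=> mA; rewrite -qE//.
  (* Testing against indicators, on the whole space and with r = 1, shows that the mixture is a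
     density of the forward variable. *)
  have m1 : measurable_fun setT (\1_A : 'rV[R]_n -> R) by exact: measurable_indic.
  have := ge0_integral_forward_state P X0 eps setT 1 a s measurableT ltr01
    indepT heps s_gt0 _ m1 (fun x => ltac:(by rewrite indicE)).
  rewrite mul1e => h.
  transitivity (\int[P]_w (\1_A (a *: X0 w + s *: eps w))%:E)%E.
    rewrite (eq_integral (fun w =>
      (\1_((fun w => a *: X0 w + s *: eps w) @^-1` A) w)%:E)); last first.
      by move=> w _; rewrite !indicE.
    rewrite integral_indic ?setIT//.
    have mX : measurable_fun setT (fun w => a *: X0 w + s *: eps w).
      by apply: measurable_rVD; exact: measurable_funP.
    by rewrite -[X in measurable X]setTI; exact: mX.
  rewrite h [in RHS]integral_mkcond; apply: eq_integral => x _.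
  by rewrite patchE indicE; case: ifPn => _; rewrite ?mul1r ?mul0r.
have qoo : (\int[lebesgue_rV n]_x (q x)%:E < +oo)%E.
  by rewrite -qE// preimage_setT probability_setT ltry.
have cM := continuous_mix_density law0 a s s_gt0.
apply/funext => x; apply/eqP; rewrite eq_le; apply/andP; split.
  by apply: (continuous_density_le n) => //; rewrite -qM.
by apply: (continuous_density_le n) => // A mA; rewrite qM.
Qed.

End identify_density.

(** * Averaging over the step index, and passage to the reverse-SDE objective *)

Theorem theorem7p6 (R : realType) (n N : nat)
  (t : nat -> R) (ht0 : t 0%N = 0) (htN : t N = 1)
  (ht : forall k : nat, (k < N)%N -> t k < t k.+1)
  (b : nat -> R) (hb : forall k : nat, (1 <= k <= N)%N -> 0 < b k < 1)
  (d : measure_display) (Omega : measurableType d) (P : probability Omega R)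
  (p0 : 'rV[R]_n -> R)
  (X0 : {RV P >-> 'rV[R]_n}) (K : {RV P >-> nat}) (eps : {RV P >-> 'rV[R]_n})
  (hX0 : has_density P X0 p0)
  (hK : uniform_on_1_to P N K)
  (heps : has_density P eps (gaussian_pdf 0 1))
  (hindep : independent3 P X0 K eps)
  (q : nat -> 'rV[R]_n -> R)
  (hq : forall k : nat, (1 <= k <= N)%N ->
     has_density P (forward_chain b X0 eps k) (q k))
  (hq_cont : forall k : nat, (1 <= k <= N)%N -> continuous (q k))
  (Theta : Type) (epsd : Theta -> 'rV[R]_n -> nat -> 'rV[R]_n)
  (hepsd : forall (theta : Theta) (k : nat), (1 <= k <= N)%N ->
     measurable_fun [set: 'rV[R]_n] (fun x => epsd theta x k)) :
  (exists C : R, forall theta : Theta,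
     ddpm_loss P b X0 K eps (epsd theta) =
     (chain_score_loss P b X0 K eps q (epsd theta) + C%:E)%E)
  /\
  (forall (alpha sigma : R -> R) (epsc : Theta -> 'rV[R]_n -> R -> 'rV[R]_n),
     (forall k : nat, (1 <= k <= N)%N ->
        [/\ continuous_process alpha sigma X0 eps (t k) =
               forward_chain b X0 eps k,
            process_density alpha sigma p0 (t k) = q k,
            alpha (t k) = Num.sqrt (alpha_bar b k),
            sigma (t k) = Num.sqrt (1 - alpha_bar b k) &
            forall (theta : Theta) (x : 'rV[R]_n),
              epsd theta x k = epsc theta x (t k)]) ->
     forall theta : Theta,
       chain_score_loss P b X0 K eps q (epsd theta) =
       reverse_sde_grid_loss sigma K t (process_density alpha sigma p0)
         (epsc theta)).
Proof.
pose law0 : probability 'rV[R]_n R := distribution P X0.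
pose a k := Num.sqrt (alpha_bar b k).
pose s k := Num.sqrt (1 - alpha_bar b k).
pose X := forward_chain b X0 eps.
pose E k := K @^-1` [set k].
pose m k := cond_noise law0 (a k) (s k).
pose M k := mix_density law0 (a k) (s k).
pose V k := residual_variance P X0 (a k) (s k).
have mE k : measurable (E k).
  by rewrite -[E k]setTI; exact: (measurable_funP K).
have s_gt0 k : (1 <= k <= N)%N -> 0 < s k.
  by move=> kN; rewrite sqrtr_gt0; exact: (alpha_bar_lt1 R b N).
have r_gt0 k : (1 <= k <= N)%N -> 0 < (N%:R^-1 : R).
  by case/andP=> k1 kN; rewrite invr_gt0 ltr0n (leq_trans k1).
have PE k : (1 <= k <= N)%N -> P (E k) = (N%:R^-1)%:E.
  by move=> kN; have := hK k; rewrite kN.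
have indepE k : (1 <= k <= N)%N -> forall A B, measurable A -> measurable B ->
    P (X0 @^-1` A `&` E k `&` eps @^-1` B) =
    ((N%:R^-1)%:E * (P (X0 @^-1` A) * P (eps @^-1` B)))%E.
  by move=> kN A B mA mB; rewrite hindep// -/(E k) PE// [(P _ * _)%E]muleC muleA.
have indepT A B : measurable A -> measurable B ->
    P (X0 @^-1` A `&` eps @^-1` B) = (P (X0 @^-1` A) * P (eps @^-1` B))%E.
  move=> mA mB; have := hindep A setT B mA measurableT mB.
  by rewrite preimage_setT setIT probability_setT mule1.
have qE k : (1 <= k <= N)%N -> q k = M k.
  move=> kN; apply: (density_forwardE P X0 eps) => //.
  - exact: s_gt0.
  - exact: hq.
  - exact: hq_cont.
(* The noise scale cancels the 1 / s of Tweedie's formula, so the score loss compares the predictor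
   with the conditional noise. *)
have scoreE k x : (1 <= k <= N)%N ->
    Num.sqrt (1 - alpha_bar b k) *: gradient (fun y => ln (q k y)) x = - m k x.
  move=> kN; rewrite qE// gradient_ln_mix_density; last exact: s_gt0.
  by rewrite scalerN scalerA divff ?scale1r// gt_eqF// s_gt0.
have mX k : measurable_fun setT (X k) by exact: measurable_rVD.
have mm k : (1 <= k <= N)%N -> measurable_fun setT (m k).
  by move=> kN; exact: (measurable_cond_noise law0 (a k) (s k) (s_gt0 k kN)).
pose S theta k x := norm2 (epsd theta x k + Num.sqrt (1 - alpha_bar b k) *:
  gradient (fun y => ln (q k y)) x) ^+ 2.
have SE theta k x : (1 <= k <= N)%N ->
    S theta k x = norm2 (epsd theta x k - m k x) ^+ 2.
  by move=> kN; rewrite /S scoreE.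
have mS theta k : (1 <= k <= N)%N -> measurable_fun setT (S theta k).
  move=> kN; rewrite (_ : S theta k =
    fun x => norm2 (epsd theta x k - m k x) ^+ 2).
    by apply: measurable_norm2_sqrB; [exact: hepsd|exact: mm].
  by apply/funext => x; rewrite SE.
have inN k : (k \in iota 1 N) = (1 <= k <= N)%N by rewrite mem_iota add1n ltnS.
have scoreS theta : chain_score_loss P b X0 K eps q (epsd theta) =
    (\sum_(k <- iota 1 N) \int[P]_(w in E k) (S theta k (X k w))%:E)%E.
  rewrite /chain_score_loss unlock.
  apply: (ge0_integral_uniform P K N hK
    (fun k w => (S theta k (X k w))%:E)) => [k kN|k w].
    by apply/measurable_EFinP; exact: (measurableT_comp (mS theta k kN) (mX k)).
  by rewrite lee_fin sqr_ge0.
split.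
  (* C is the average of the residual variances over k; these are finite, so [fine] loses
     nothing. *)
  exists (\sum_(k <- iota 1 N) (N%:R^-1 * fine (V k))) => theta.
  rewrite scoreS -sumEFin -big_split/= /ddpm_loss unlock.
  pose F k w := (norm2 (epsd theta (X k w) k - eps w) ^+ 2)%:E.
  rewrite -[LHS]/(\int[P]_w F (K w) w)%E.
  rewrite (ge0_integral_uniform P K N hK F); first last.
  - by move=> k w; rewrite lee_fin sqr_ge0.
  - move=> k kN; apply/measurable_EFinP; apply: measurable_norm2_sqrB.
      exact: (measurableT_comp (hepsd theta k kN) (mX k)).
    exact: measurable_funP.
  apply: eq_big_seq => k; rewrite inN => kN.
  rewrite /F (denoising_decomposition P X0 eps (E k) (N%:R^-1) (a k) (s k)
    (mE k) (r_gt0 k kN) (indepE k kN) heps (s_gt0 k kN)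
    (fun x => epsd theta x k) (hepsd theta k kN)).
  congr (_ + _)%E.
    by apply: eq_integral => w _; rewrite SE.
  rewrite EFinM fineK// ge0_fin_numE.
    exact: (residual_variance_lty P X0 eps (E k) (N%:R^-1) (a k) (s k)
      (mE k) (r_gt0 k kN) (indepE k kN) heps (s_gt0 k kN)).
  exact: (residual_variance_ge0 P X0 (a k) (s k) (s_gt0 k kN)).
move=> alpha sigma epsc ident theta.
have [_ p0_ge0 _] := hX0.
pose p := process_density alpha sigma p0.
have p_ge0 u x : 0 <= p u x.
  apply: Rintegral_ge0 => z _; rewrite mulr_ge0// mulr_ge0 ?expR_ge0//.
  by rewrite exprn_ge0// normal_peak_ge0.
pose H k := (\int[lebesgue_rV n]_x
  (norm2 (epsc theta x (t k) + sigma (t k) *: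
     gradient (fun y => ln (p (t k) y)) x) ^+ 2 * p (t k) x)%:E)%E.
have H_ge0 k : (0 <= H k)%E.
  by apply: integral_ge0 => x _; rewrite lee_fin mulr_ge0// sqr_ge0.
rewrite scoreS /reverse_sde_grid_loss -[RHS]/(\int[distribution P K]_k H k)%E.
rewrite ge0_integral_distribution//.
rewrite (ge0_integral_uniform P K N hK (fun k _ => H k))//.
apply: eq_big_seq => k; rewrite inN => kN.
(* On the event K = k the inner expectation is constant, so it contributes H k / N. *)
have -> : (\int[P]_(w in K @^-1` [set k]) H k = H k * P (E k))%E.
  exact: (integral_cst P (mE k)).
rewrite PE// muleC.
(* The chain expectation becomes an integral against the mixture density, which equals q_k and hence
   p_{t_k}; the integrands then agree pointwise. *)
rewrite (ge0_integral_forward_state P X0 eps (E k) (N%:R^-1) (a k) (s k)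
  (mE k) (r_gt0 k kN) (indepE k kN) heps (s_gt0 k kN)
  _ (mS theta k kN) (fun x => sqr_ge0 _)).
congr (_ * _)%E; apply: eq_integral => x _.
have [_ pq _ sE eE] := ident k kN.
by rewrite /S /p pq sE eE qE.
Qed.
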